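(* Let $S_1,\ldots,S_N:\mathbb{R}^d\to\mathbb{R}^d$ be contracting similarities, let $r_i\in(0,1)$ be the similarity ratio of $S_i$, and let $(p_1,\ldots,p_N)$ be a probability vector with all $p_i>0$. Let $\mu$ be the unique Borel probability measure on $\mathbb{R}^d$ with $\mu=\sum_i p_i\,\mu\circ S_i^{-1}$. Assume that the list $(S_1,\ldots,S_N)$ satisfies the Open Set Condition. For $\alpha\in\mathbb{R}$ and $r>0$ let $$\zeta_\alpha^{\mathrm{sim}}(s;r)=\sum_{\mathbf{i}\in\Sigma^*,\ \left|\frac{\log p_{\mathbf{i}}}{\log r_{\mathbf{i}}}-\alpha\right|\le r} r_{\mathbf{i}}^{\,s}$$ for those complex numbers $s$ for which the series converges absolutely, and let $\sigma_{\mathrm{ab}}(\zeta_\alpha^{\mathrm{sim}}(\cdot;r))$ be its abscissa of convergence. Then for every $\alpha\in\mathbb{R}$, $$\lim_{r\searrow0}\sigma_{\mathrm{ab}}\big(\zeta_\alpha^{\mathrm{sim}}(\cdot;r)\big)=f_\mu(\alpha)=f_\mu^{\mathrm{c}}(\alpha).$$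
   Context: $\Sigma^*=\{i_1\ldots i_n : n\in\mathbb{N},\ i_j\in\{1,\ldots,N\}\}$ is the set of all finite strings; for $\mathbf{i}=i_1\ldots i_n\in\Sigma^*$ write $r_{\mathbf{i}}=r_{i_1}\cdots r_{i_n}$ and $p_{\mathbf{i}}=p_{i_1}\cdots p_{i_n}$. Open Set Condition (OSC): there is a non-empty bounded open set $O$ with $S_iO\subseteq O$ for all $i$ and $S_iO\cap S_jO=\varnothing$ for all $i\ne j$. For a zeta-function $\zeta(s)=\sum_{\mathbf{i}}a_{\mathbf{i}}^s$ with $a_{\mathbf{i}}>0$, $\sigma_{\mathrm{ab}}(\zeta)=\inf\{t\in\mathbb{R}: \sum_{\mathbf{i}}a_{\mathbf{i}}^t \text{ converges absolutely}\}\in[-\infty,\infty]$ (so it is $-\infty$ for an empty or finite sum). Multifractal spectrum: with $K=\operatorname{supp}\mu$, $f_\mu(\alpha)=\dim_{\mathrm H}\{x\in K:\lim_{r\searrow0}\frac{\log\mu(B(x,r))}{\log r}=\alpha\}$, where $\dim_{\mathrm H}$ is Hausdorff dimension, $B(x,r)$ is the ball with center $x$ and radius $r$, and by convention $\dim_{\mathrm H}\varnothing=-\infty$. Coarse multifractal spectrum: for $r,\delta>0$ let $N_{\mu,\delta}(\alpha;r)$ be the supremum of $|I|$ over all finite families of balls $(B(x_i,\delta))_{i\in I}$ with $x_i\in K$ for all $i$, $B(x_i,\delta)\cap B(x_j,\delta)=\varnothing$ for $i\ne j$, and $\alpha-r\le\frac{\log\mu(B(x_i,\delta))}{\log\delta}\le\alpha+r$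 for all $i$. Put $f_\mu^{\mathrm c}(\alpha;r)=\liminf_{\delta\searrow0}\frac{\log N_{\mu,\delta}(\alpha;r)}{-\log\delta}$ (with $\log0=-\infty$) and $f_\mu^{\mathrm c}(\alpha)=\lim_{r\searrow0}f_\mu^{\mathrm c}(\alpha;r)$. *)

(* Defs.v *)
From HB Require Import structures.
From mathcomp Require Import all_boot all_order all_algebra.
From mathcomp Require Import all_classical all_reals all_analysis.
Import Order.TTheory GRing.Theory Num.Theory.
Import numFieldNormedType.Exports.

Set Implicit Arguments.
Unset Strict Implicit.
Unset Printing Implicit Defensive.

Local Open Scope classical_set_scope.
Local Open Scope ring_scope.

(* R^d is ['rV[R]_d].  The library norm there is the sup norm; it is only used
   through [open] and [bounded_set], which agree with their Euclidean versions.
   Balls, diameters and similarities use the Euclidean distance below. *)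
Definition edist (R : realType) (d : nat) (x y : 'rV[R]_d) : R :=
  Num.sqrt (\sum_(j < d) (x ord0 j - y ord0 j) ^+ 2).

(* Balls are closed. *)
Definition eball (R : realType) (d : nat) (x : 'rV[R]_d) (r : R) :
  set 'rV[R]_d := [set y | edist x y <= r].

Notation borelRd R d := (g_sigma_algebraType (@open 'rV[R]_d)).

Definition is_similarity (R : realType) (d : nat)
    (S : 'rV[R]_d -> 'rV[R]_d) (r : R) : Prop :=
  forall x y, edist (S x) (S y) = r * edist x y.

Definition open_set_condition (R : realType) (d N : nat)
    (S : 'I_N -> 'rV[R]_d -> 'rV[R]_d) : Prop :=
  exists O : set 'rV[R]_d,
    [/\ O !=set0, bounded_set O, open O,
        forall i, S i @` O `<=` O &
        forall i j, i != j -> (S i @` O) `&` (S j @` O) = set0].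

Definition self_similar_measure (R : realType) (d N : nat)
    (S : 'I_N -> 'rV[R]_d -> 'rV[R]_d) (p : 'I_N -> R)
    (mu : probability (borelRd R d) R) : Prop :=
  forall A : set (borelRd R d), measurable A ->
    mu A = (\sum_(i < N) (p i)%:E * mu (S i @^-1` A))%E.

Definition supp (R : realType) (d : nat)
    (mu : probability (borelRd R d) R) : set 'rV[R]_d :=
  [set x | forall U : set 'rV[R]_d, open U -> U x -> (0 < mu U)%E].

(* [r_w] and [p_w] for a finite string [w]. *)
Definition wprod (R : realType) (N : nat) (q : 'I_N -> R) (w : seq 'I_N) : R :=
  \prod_(i <- w) q i.

(* Abscissa of convergence of [sum_(w in W) a_w ^ s], in [-oo, +oo]. *)
Definition abscissa (R : realType) (I : choiceType) (W : set I) (a : I -> R) :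
  \bar R :=
  ereal_inf [set t%:E | t in [set t : R | summable W (fun w => (a w `^ t)%:E)]].

(* Index set of [zeta_alpha^sim(.; rho)].  The empty string is left out: the
   quotient of logarithms is 0/0 there.  *)
Definition zeta_sim_index (R : realType) (N : nat) (r p : 'I_N -> R)
    (alpha rho : R) : set (seq 'I_N) :=
  [set w | w <> [::] /\
           `| ln (wprod p w) / ln (wprod r w) - alpha | <= rho].

Definition sigma_ab_zeta_sim (R : realType) (N : nat) (r p : 'I_N -> R)
    (alpha rho : R) : \bar R :=
  abscissa (zeta_sim_index r p alpha rho) (wprod r).

(* [diam set0 = -oo]; empty sets are treated separately in [gauge]. *)
Definition diam (R : realType) (d : nat) (A : set 'rV[R]_d) : \bar R :=
  ereal_sup [set (edist xy.1 xy.2)%:E | xy in A `*` A].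

(* [diam(A)^s], with [diam(set0)^s = 0] and [0^0 = 1] for nonempty sets (so
   that the 0-dimensional Hausdorff measure is the counting measure). *)
Definition gauge (R : realType) (d : nat) (s : R) (A : set 'rV[R]_d) : \bar R :=
  if `[< A = set0 >] then 0%E else (diam A `^ s)%E.

Definition hausdorff_premeasure (R : realType) (d : nat) (s delta : R)
    (A : set 'rV[R]_d) : \bar R :=
  ereal_inf [set (\sum_(0 <= n <oo) gauge s (U n))%E |
    U in [set U : nat -> set 'rV[R]_d |
            A `<=` \bigcup_n U n /\ forall n, (diam (U n) <= delta%:E)%E]].

Definition hausdorff_measure (R : realType) (d : nat) (s : R)
    (A : set 'rV[R]_d) : \bar R :=
  ereal_sup [set hausdorff_premeasure s delta A |
               delta in [set delta : R | 0 < delta]].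

Definition hausdorff_dim (R : realType) (d : nat) (A : set 'rV[R]_d) : \bar R :=
  if `[< A = set0 >] then -oo%E
  else ereal_inf [set s%:E |
                   s in [set s : R | 0 <= s /\ hausdorff_measure s A = 0%E]].

Definition mf_spectrum (R : realType) (d : nat)
    (mu : probability (borelRd R d) R) (alpha : R) : \bar R :=
  hausdorff_dim
    [set x | supp mu x /\
       (ln (fine (mu (eball x r))) / ln r @[r --> 0^'+] --> alpha)].

(* Finite families of balls are indexed by ['I_n]. *)
Definition coarse_packing (R : realType) (d : nat)
    (mu : probability (borelRd R d) R) (alpha r delta : R) (n : nat)
    (x : 'I_n -> 'rV[R]_d) : Prop :=
  [/\ forall i, supp mu (x i),
      forall i j, i != j -> eball (x i) delta `&` eball (x j) delta = set0 &
      forall i, alpha - r <= ln (fine (mu (eball (x i) delta))) / ln delta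
                          <= alpha + r].

Definition coarse_number (R : realType) (d : nat)
    (mu : probability (borelRd R d) R) (alpha r delta : R) : \bar R :=
  ereal_sup [set (n%:R : R)%:E |
    n in [set n : nat | exists x : 'I_n -> 'rV[R]_d,
                          coarse_packing mu alpha r delta x]].

(* [lne 0 = -oo]. *)
Definition coarse_spectrum_at (R : realType) (d : nat)
    (mu : probability (borelRd R d) R) (alpha r : R) : \bar R :=
  limf_einf
    (fun delta : R =>
       (lne (coarse_number mu alpha r delta) * ((- ln delta)^-1)%:E)%E) 0^'+.

(* [coarse_spectrum_at mu alpha r] is nondecreasing in [r], so this limit
   exists. *)
Definition coarse_spectrum (R : realType) (d : nat)
    (mu : probability (borelRd R d) R) (alpha : R) : \bar R :=
  lim (coarse_spectrum_at mu alpha r @[r --> 0^'+]).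

(* Main.v *)
From Pilot Require Import Defs.
From HB Require Import structures.
From mathcomp Require Import all_boot all_order all_algebra.
From mathcomp Require Import all_classical all_reals all_analysis.
From mathcomp Require Import ring lra.
Import Order.TTheory GRing.Theory Num.Theory.
Import numFieldNormedType.Exports.
(* [edist] is the Euclidean distance, not the extended distance of metric spaces *)
Import Pilot.Defs.

(** Write [sigma rho] for the abscissa with tolerance [rho], [f] for the
    multifractal spectrum and [coarse rho] for the coarse spectrum with tolerance
    [rho], all at the same [alpha].  Since [sigma] and [coarse] are nondecreasing
    in [rho], the theorem follows from the cycle

      inf sigma <= f <= inf coarse <= inf sigma.

    No pressure function and no Legendre transform is used: the concavity that
    duality usually provides comes from concatenating words.  The support of the
    measure is replaced by a closed ball [D] of full measure that every [S_i] maps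
    into itself; the piece of a word [w] is [S_w D].

    - [f <= coarse rho] holds for every probability measure.  The set where the
      local dimension is [alpha] is a countable union of sets on which the
      measure of all small balls is uniformly controlled.  If the whole set has
      positive Hausdorff measure, so has one of the parts, and maximal packings
      centred in this part must be large ([mf_spectrum_le_coarse]).

    - [coarse r1 <= sigma rho] for [r1 < rho].  A packing by many balls of radius
      [delta] yields two prefix-free families of words of size about [delta]: a
      piece inside each ball, of mass at most that of the ball, and a piece meeting
      each ball and carrying a fixed part of its mass.  The open set condition
      makes both families about as large as the packing.  The quotients of
      logarithms are almost at least [alpha] on the first family and almost at
      most [alpha] on the second, so words concatenated from both, with the choice
      at each step correcting the current error, have quotients near [alpha]; they
      carry so much weight that the series diverges ([mixing_le_abscissa]).

    - [t <= f] for [t] below all the abscissas.  Divergence of the series gives,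
      for arbitrarily large [n], words of length [n] with quotient near [alpha] and
      total weight at least [1] ([abscissa_lt_levels]).  Concatenating such
      blocks, with tolerances tending slowly to [0], gives a Moran set.  Between
      blocks one inserts a fixed word [u] that keeps a piece away from all pieces
      branching off earlier ([exists_isolated_word]); this is where the open set
      condition is improved to a strong one.  Hence the local dimension along every
      path is [alpha] ([path_point_local_dim]), and the weights form a mass
      distribution showing that the Moran set is not null in any dimension below
      [t] ([path_points_hausdorff_pos], by [branch_avoiding]). *)

Set Implicit Arguments.
Unset Strict Implicit.
Unset Printing Implicit Defensive.

Local Open Scope classical_set_scope.
Local Open Scope ring_scope.

(** * Euclidean distance, balls and similarities *)

Section Euclid.
Variables (R : realType) (d : nat).
Implicit Types (x y z : 'rV[R]_d).

Lemma edist_ge0 x y : 0 <= edist x y.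
Proof. exact: sqrtr_ge0. Qed.

Lemma sqr_edist x y :
  edist x y ^+ 2 = \sum_(j < d) (x ord0 j - y ord0 j) ^+ 2.
Proof. by rewrite sqr_sqrtr// sumr_ge0// => j _; rewrite sqr_ge0. Qed.

Lemma edistxx x : edist x x = 0.
Proof.
rewrite /edist big1 ?sqrtr0// => j _.
by rewrite subrr expr0n.
Qed.

Lemma edistC x y : edist x y = edist y x.
Proof.
congr Num.sqrt; apply: eq_bigr => j _.
by rewrite -sqrrN opprB.
Qed.

Lemma cauchy_schwarz_sum (a b : 'I_d -> R) :
  (\sum_j a j * b j) ^+ 2 <= (\sum_j a j ^+ 2) * (\sum_j b j ^+ 2).
Proof.
set A := \sum_j a j ^+ 2; set B := \sum_j b j ^+ 2; set C := \sum_j _.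
have B0 : 0 <= B by apply: sumr_ge0 => j _; rewrite sqr_ge0.
have [B1|B1] := ltP 0 B; last first.
  have {B0 B1} B0 : B = 0 by apply/eqP; rewrite eq_le B0 B1.
  have b0 j : b j = 0.
    move/eqP: B0; rewrite psumr_eq0; last by move=> i _; rewrite sqr_ge0.
    by move=> /allP/(_ j (mem_index_enum _)); rewrite sqrf_eq0 => /eqP.
  by rewrite /C big1 ?B0 ?mulr0 ?expr0n// => j _; rewrite b0 mulr0.
(* expanding the squares of [B * a j - C * b j] leaves [B] times the defect *)
have : 0 <= \sum_j (B * a j - C * b j) ^+ 2.
  by apply: sumr_ge0 => j _; rewrite sqr_ge0.
rewrite (_ : \sum_j _ = B * (A * B - C ^+ 2)).
  by rewrite pmulr_rge0// subr_ge0.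
transitivity (\sum_j (B ^+ 2 * a j ^+ 2 - 2 * B * C * (a j * b j)
                     + C ^+ 2 * b j ^+ 2)).
  by apply: eq_bigr => j _; ring.
rewrite big_split/= sumrB -!mulr_sumr -/A -/B -/C.
ring.
Qed.

Lemma edist_triangle y x z : edist x z <= edist x y + edist y z.
Proof.
rewrite -ler_sqr ?nnegrE ?addr_ge0 ?edist_ge0// sqrrD !sqr_edist.
set a := fun j => x ord0 j - y ord0 j; set b := fun j => y ord0 j - z ord0 j.
have -> : \sum_(j < d) (x ord0 j - z ord0 j) ^+ 2 =
   \sum_j a j ^+ 2 + (\sum_j a j * b j) *+ 2 + \sum_j b j ^+ 2.
  rewrite -sumrMnl -!big_split/=; apply: eq_bigr => j _.
  rewrite /a /b; ring.
rewrite lerD2r lerD2l lerMn2r/=.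
rewrite (le_trans (ler_norm _))// -ler_sqr ?nnegrE ?mulr_ge0 ?edist_ge0//.
by rewrite exprMn !sqr_edist -normrX ger0_norm ?sqr_ge0// cauchy_schwarz_sum.
Qed.

Lemma coord_le_edist x y j : `|x ord0 j - y ord0 j| <= edist x y.
Proof.
rewrite -ler_sqr ?nnegrE ?edist_ge0// sqr_edist -normrX ger0_norm ?sqr_ge0//.
rewrite (bigD1 j)//= lerDl.
by apply: sumr_ge0 => i _; rewrite sqr_ge0.
Qed.

Lemma edist_le_sum x y : edist x y <= \sum_j `|x ord0 j - y ord0 j|.
Proof.
rewrite -ler_sqr ?nnegrE ?edist_ge0 ?sumr_ge0// sqr_edist.
pose K (u v : R) := 0 <= v /\ u <= v ^+ 2.
have [] : K (\sum_(j < d) (x ord0 j - y ord0 j) ^+ 2)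
            (\sum_j `|x ord0 j - y ord0 j|); last by [].
elim/big_ind2 : _ => [|a b c e [b0 ab] [e0 ce]|j _]; rewrite /K.
- by rewrite expr0n.
- split; first exact: addr_ge0.
  rewrite sqrrD (le_trans (lerD ab ce))// -addrA [_ *+ 2 + _]addrC addrA lerDl.
  by rewrite mulrn_wge0// mulr_ge0.
- by split; rewrite ?normr_ge0// -normrX ger0_norm ?sqr_ge0.
Qed.

Lemma edist_le_norm x y : edist x y <= d%:R * `|x - y|.
Proof.
apply: le_trans (edist_le_sum x y) _.
rewrite -[d in d%:R]card_ord -sum1_card natr_sum mulr_suml ler_sum// => j _.
rewrite mul1r [leRHS]/Num.norm/= mx_normrE.
by have := le_bigmax_cond 0 (fun i : 'I_1 * 'I_d => `|(x - y) i.1 i.2|)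
  (erefl : xpredT (ord0, j)); rewrite !mxE.
Qed.

Lemma norm_le_edist x y : `|x - y| <= edist x y.
Proof.
rewrite [leLHS]/Num.norm/= mx_normrE; apply/bigmax_leP; split; first exact: edist_ge0.
by move=> [i j] _; rewrite ord1 !mxE/=; exact: coord_le_edist.
Qed.

Lemma open_eball_sub (U : set 'rV[R]_d) x : open U -> U x ->
  exists2 c, 0 < c & eball x c `<=` U.
Proof.
move=> oU Ux; have /nbhs_ballP[e /= e0 eU] := open_nbhs_nbhs (conj oU Ux).
exists (e / 2); first by rewrite divr_gt0.
move=> y xy; apply: eU; rewrite -ball_normE/=.
by apply: (le_lt_trans (norm_le_edist _ _)); apply: (le_lt_trans xy); lra.
Qed.

Lemma closed_eball x r : closed (eball x r).
Proof.
rewrite -openC openE => y /= /negP; rewrite -ltNge => yr; rewrite /interior.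
apply/nbhs_ballP; exists ((edist x y - r) / d.+1%:R) => /=.
  by rewrite divr_gt0// subr_gt0.
move=> z; rewrite -ball_normE/= ltr_pdivlMr// => yz; apply/negP; rewrite -ltNge.
have := edist_triangle z x y; have := edist_le_norm z y.
have : `|y - z| * d%:R <= `|y - z| * d.+1%:R by rewrite ler_wpM2l// ler_nat.
rewrite (distrC z y) [d%:R * _]mulrC; lra.
Qed.

Lemma measurable_eball x r : measurable (eball x r : set (borelRd R d)).
Proof.
rewrite -[eball x r]setCK; apply: measurableC.
by apply: sub_sigma_algebra; rewrite /= openC; exact: closed_eball.
Qed.

Lemma eball_center x r : 0 <= r -> eball x r x.
Proof. by move=> r0; rewrite /eball/= edistxx. Qed.

(** Distances to [0] determine inner products by polarization, so an isometry
    fixing [0] is read off from the images of the basis vectors. *)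
Lemma isometry_mulmx (T : 'rV[R]_d -> 'rV[R]_d) :
  is_similarity T 1 -> T 0 = 0 ->
  exists2 A : 'M[R]_d, A *m A^T = 1%:M & forall x, T x = x *m A.
Proof.
move=> T1 T0.
pose dot x y : R := \sum_j x ord0 j * y ord0 j.
have polar x y : edist x y ^+ 2 = edist x 0 ^+ 2 + edist y 0 ^+ 2 - 2 * dot x y.
  rewrite !sqr_edist /dot mulr_sumr -big_split/= -sumrB.
  by apply: eq_bigr => j _; rewrite !mxE; ring.
have dotT x y : dot (T x) (T y) = dot x y.
  have := polar (T x) (T y); rewrite -{1 2}T0 !T1 !mul1r polar.
  by move=> /addrI/oppr_inj /mulfI ->//; rewrite pnatr_eq0.
pose A := \matrix_(i < d, j < d) T (delta_mx ord0 i) ord0 j.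
have dotA x i : (T x *m A^T) ord0 i = x ord0 i.
  rewrite mxE -[RHS]mulr1.
  transitivity (dot (T x) (T (delta_mx ord0 i))).
    by apply: eq_bigr => j _; rewrite !mxE.
  rewrite dotT /dot (bigD1 i)//= big1 ?addr0 ?mxE ?eqxx//.
  by move=> j ji; rewrite mxE eqxx/= (negbTE ji) mulr0.
have AAT : A *m A^T = 1%:M.
  apply/matrixP => i j; have := dotA (delta_mx ord0 i) j.
  rewrite !mxE eq_refl/= eq_sym => <-.
  by apply: eq_bigr => k _; rewrite !mxE.
exists A => // x.
have -> : x = T x *m A^T by apply/rowP => i; rewrite dotA.
rewrite -mulmxA (mulmx1C AAT) mulmx1; congr T.
by apply/rowP => i; rewrite dotA.
Qed.

(** A similarity of a Euclidean space is automatically onto: up to scaling and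
    translation it preserves inner products, hence is given by an orthogonal
    matrix. *)
Lemma similarity_bij (S : 'rV[R]_d -> 'rV[R]_d) (r : R) : 0 < r ->
  is_similarity S r -> exists T, cancel S T /\ cancel T S.
Proof.
move=> r0 Sr; pose T x := r^-1 *: (S x - S 0).
have T1 : is_similarity T 1.
  move=> x y; rewrite mul1r -[RHS]mul1r -(mulVf (lt0r_neq0 r0)) -mulrA -Sr.
  rewrite /edist -[r^-1]gtr0_norm ?invr_gt0// -sqrtr_sqr -sqrtrM ?sqr_ge0//.
  congr Num.sqrt; rewrite mulr_sumr; apply: eq_bigr => j _.
  by rewrite /T !mxE; ring.
have T0 : T 0 = 0 by rewrite /T subrr scaler0.
have [A AAT TA] := isometry_mulmx T1 T0.
have SE x : S x = r *: (x *m A) + S 0.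
  by rewrite -TA /T scalerA divff ?gt_eqF// scale1r subrK.
exists (fun y => (r^-1 *: (y - S 0)) *m A^T); split => x.
  rewrite SE addrK scalerA mulVf ?gt_eqF// scale1r -mulmxA AAT.
  by rewrite mulmx1.
by rewrite SE -mulmxA (mulmx1C AAT) mulmx1 scalerA divff ?gt_eqF// scale1r subrK.
Qed.

(** This keeps self-similarity, which speaks of preimages of measurable sets,
    within the class of balls. *)
Lemma similarity_preimage_eball (S T : 'rV[R]_d -> 'rV[R]_d) (r : R) y s : 0 < r ->
  is_similarity S r -> cancel T S ->
  S @^-1` eball y s = eball (T y) (s / r).
Proof.
move=> r0 Sr TK; have E x : (edist y (S x) <= s) = (edist (T y) x <= s / r).
  by rewrite -{1}(TK y) Sr ler_pdivlMr// mulrC.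
by apply/seteqP; split => x; rewrite /eball /= E.
Qed.

(** Points of a ball at mutual distance at least [s] lie in different cells of
    a grid of mesh [s / d], and only finitely many cells meet the ball. *)
Lemma card_separated (s C : R) : (0 < d)%N -> 0 < s -> 0 < C ->
  exists M : nat, forall (c : 'rV[R]_d) (rho : R) (I : finType)
    (x : I -> 'rV[R]_d), 0 < rho ->
    (forall i, edist (x i) c <= C * rho) ->
    (forall i j, i != j -> s * rho <= edist (x i) (x j)) -> (#|I| <= M)%N.
Proof.
move=> d0 s0 C0.
(* the number of cells of mesh [s * rho / d] along an edge of length [2 * C * rho] *)
pose K := (Num.truncn (2 * C * d%:R / s)).+1.
have dR : 0 < d%:R :> R by rewrite ltr0n.
exists (K ^ d)%N => c rho I x rho0 xc xs.
pose cell i j := (x i ord0 j - c ord0 j + C * rho) * d%:R / (s * rho).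
have cell_ge0 i j : 0 <= cell i j.
  have := le_trans (coord_le_edist (x i) c j) (xc i); rewrite ler_norml => /andP[h _].
  apply: divr_ge0; last by rewrite mulr_ge0 ?ltW.
  by apply: mulr_ge0; [lra|exact: ltW].
have cellK i j : (Num.truncn (cell i j) < K)%N.
  rewrite ltnS le_truncn//.
  have := le_trans (coord_le_edist (x i) c j) (xc i); rewrite ler_norml => /andP[_ h].
  rewrite ler_pdivrMr ?mulr_gt0// [leRHS](_ : _ = 2 * C * rho * d%:R).
    apply: ler_wpM2r; [exact: ltW|lra].
  by field; rewrite gt_eqF.
pose f i : {ffun 'I_d -> 'I_K} := [ffun j => Ordinal (cellK i j)].
have finj : injective f.
  move=> i i' ff; apply/eqP/negPn/negP => /xs; apply/negP; rewrite -ltNge.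
  apply: le_lt_trans (edist_le_sum _ _) _.
  have cc j : `|x i ord0 j - x i' ord0 j| < s * rho / d%:R.
    have /(congr1 (fun g : {ffun 'I_d -> 'I_K} => val (g j))) := ff.
    rewrite !ffunE/= => tt.
    have := truncn_itv (cell_ge0 i j); have := truncn_itv (cell_ge0 i' j).
    rewrite tt; set n := Num.truncn _; rewrite -natr1 => /andP[h1 h2] /andP[h3 h4].
    have -> : x i ord0 j - x i' ord0 j = (cell i j - cell i' j) * (s * rho / d%:R).
      by rewrite /cell; field; rewrite !gt_eqF.
    have k0 : 0 < s * rho / d%:R by rewrite divr_gt0// mulr_gt0.
    rewrite normrM (gtr0_norm k0) -[ltRHS]mul1r ltr_pM2r//.
    rewrite ltr_norml; apply/andP; split; lra.
  rewrite [ltRHS](_ : _ = \sum_(j < d) s * rho / d%:R).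
    apply: ltr_sum => //; apply/hasP; exists (Ordinal d0) => //.
  by rewrite sumr_const card_ord -[RHS]mulr_natr divfK// gt_eqF.
rewrite -(card_codom finj) (leq_trans (max_card _))//.
by rewrite card_ffun !card_ord.
Qed.

End Euclid.

(** * Words and stopping families *)

Lemma prefix_comparable (T : eqType) (u v z : seq T) :
  prefix u z -> prefix v z -> (size u <= size v)%N -> prefix u v.
Proof.
rewrite !prefixE => /eqP uz /eqP vz uv.
by rewrite -vz take_takel// uz.
Qed.

Lemma prefix_same_size (T : eqType) (u v z : seq T) :
  prefix u z -> prefix v z -> size u = size v -> u = v.
Proof. by rewrite !prefixE => /eqP uz /eqP vz s; rewrite -[LHS]uz -[RHS]vz s. Qed.

Lemma nested_words (T : Type) (z : nat -> seq T) m n :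
  (forall k, exists s, z k.+1 = z k ++ s) -> (m <= n)%N ->
  exists s, z n = z m ++ s.
Proof.
move=> hz; elim: n => [|n IH].
  by rewrite leqn0 => /eqP ->; exists [::]; rewrite cats0.
rewrite leq_eqVlt => /predU1P[->|]; first by exists [::]; rewrite cats0.
rewrite ltnS => /IH[s zs]; have [s' zs'] := hz n.
by exists (s ++ s'); rewrite zs' zs catA.
Qed.

Lemma ler_sum_subset (R : numDomainType) (T : eqType) (s s' : seq T) (f : T -> R) :
  uniq s -> uniq s' -> {subset s <= s'} -> (forall x, 0 <= f x) ->
  \sum_(x <- s) f x <= \sum_(x <- s') f x.
Proof.
move=> us us' ss f0; rewrite [leRHS](bigID (mem s))/=.
rewrite -[X in _ <= X + _]big_filter [X in _ <= X + _](perm_big s)/=; last first.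
  apply: uniq_perm => //; first exact: filter_uniq.
  by move=> x; rewrite mem_filter; case: (boolP (x \in s)) => // /ss ->.
by rewrite lerDl sumr_ge0.
Qed.

(** The default value [1 / 2] of both extrema keeps them in the open unit
    interval. *)
Lemma ratio_bounds (R : realType) (N : nat) (r : 'I_N -> R) :
  (forall i, 0 < r i < 1) ->
  exists a b : R, [/\ 0 < a, a <= b, b < 1 & forall i, a <= r i <= b].
Proof.
move=> hr; exists (\big[Num.min/2^-1]_i r i), (\big[Num.max/2^-1]_i r i).
split.
- by apply/bigmin_gtP; split => // i _; case/andP: (hr i).
- apply: (@le_trans _ _ 2^-1); [exact: bigmin_le_id|exact: bigmax_ge_id].
- by apply/bigmax_ltP; split => [|i _]; [lra|case/andP: (hr i)].
- by move=> i; rewrite bigmin_le_cond ?le_bigmax_cond.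
Qed.

Section Words.
Variables (R : realType) (N : nat).
Notation word := (seq 'I_N).
Implicit Types (q : 'I_N -> R) (u v w : word).

Lemma wprod_nil q : wprod q [::] = 1.
Proof. exact: big_nil. Qed.

Lemma wprod_cons q i w : wprod q (i :: w) = q i * wprod q w.
Proof. exact: big_cons. Qed.

Lemma wprod_cat q v w : wprod q (v ++ w) = wprod q v * wprod q w.
Proof. exact: big_cat. Qed.

Lemma wprod_gt0 q w : (forall i, 0 < q i) -> 0 < wprod q w.
Proof. by move=> q0; apply: prodr_gt0. Qed.

Lemma wprod_le_exp q (b : R) w : (forall i, 0 <= q i <= b) ->
  wprod q w <= b ^+ size w.
Proof.
move=> qb; elim: w => [|i w IH]; first by rewrite wprod_nil expr0.
rewrite wprod_cons exprS; case/andP: (qb i) => q0 qib.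
by apply: ler_pM => //; apply: prodr_ge0 => j _; case/andP: (qb j).
Qed.

(** [nlog r w] plays the role of a length and [nlog p w] that of an energy:
    both are additive under concatenation. *)
Definition nlog q w : R := - ln (wprod q w).

Lemma nlog_nil q : nlog q [::] = 0.
Proof. by rewrite /nlog wprod_nil ln1 oppr0. Qed.

Lemma nlog_cat q v w : (forall i, 0 < q i) ->
  nlog q (v ++ w) = nlog q v + nlog q w.
Proof.
by move=> q0; rewrite /nlog wprod_cat lnM ?posrE ?wprod_gt0// opprD.
Qed.

Lemma wprod_nlog q w : (forall i, 0 < q i) -> wprod q w = expR (- nlog q w).
Proof. by move=> q0; rewrite /nlog opprK lnK// posrE wprod_gt0. Qed.

(** All weights are compared through this exponential form. *)
Lemma powR_nlog q w t : (forall i, 0 < q i) ->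
  wprod q w `^ t = expR (- (t * nlog q w)).
Proof.
move=> q0; rewrite /powR gt_eqF ?wprod_gt0//; congr expR.
by rewrite /nlog mulrN opprK.
Qed.

Definition level n : seq word := [seq val t | t <- enum {: n.-tuple 'I_N}].

Lemma level_uniq n : uniq (level n).
Proof. by rewrite map_inj_uniq ?enum_uniq//; exact: val_inj. Qed.

Lemma mem_level n w : (w \in level n) = (size w == n).
Proof.
apply/mapP/eqP => [[t _ ->]|wn]; first by rewrite size_tuple.
by exists (tcast wn (in_tuple w)); rewrite ?mem_enum//= val_tcast.
Qed.

Definition prefix_free (A : seq word) :=
  forall v w, v \in A -> w \in A -> prefix v w -> v = w.

Section Cut.
Variables (r : 'I_N -> R) (ra rb : R).
Hypotheses (ra0 : 0 < ra) (rab : ra <= rb) (rb1 : rb < 1)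
  (hr : forall i, ra <= r i <= rb).

Let r0 i : 0 < r i. Proof. by case/andP: (hr i) => h _; exact: lt_le_trans h. Qed.
Let rb0 : 0 < rb. Proof. exact: lt_le_trans rab. Qed.

Fixpoint cutn n rho : seq word :=
  if n is n'.+1 then
    if 1 < rho then [:: [::]]
    else [seq i :: v | i <- enum 'I_N, v <- cutn n' (rho / r i)]
  else [:: [::]].

(** The words along which the contraction ratio first drops below [rho]; the
    fuel of the recursion is any number beyond which it has no effect. *)
Definition cut rho : seq word :=
  cutn (xget 0%N [set n | forall m, (n <= m)%N -> cutn m rho = cutn n rho]) rho.

Lemma cutn_stable n m rho : rb ^+ n < rho -> (n <= m)%N ->
  cutn m rho = cutn n rho.
Proof.
elim: n m rho => [|n IH] [|m] rho //=; first by rewrite expr0 => ->.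
case: ifPn => // _; rewrite ltnS exprS => nrho nm; congr flatten.
apply: eq_map => i; rewrite (IH m)// ltr_pdivlMr// mulrC.
by apply: le_lt_trans nrho; rewrite ler_wpM2r ?exprn_ge0 ?(ltW rb0)//; case/andP: (hr i).
Qed.

Lemma exists_fuel rho : 0 < rho -> exists n, rb ^+ n < rho.
Proof.
move=> rho0; have : rb ^+ n @[n --> \oo] --> (0 : R).
  by apply: cvg_expr; rewrite gtr0_norm.
move=> /cvgr0Pnorm_lt/(_ _ rho0)[n _ /(_ n (leqnn n))].
by rewrite /= gtr0_norm ?exprn_gt0//; exists n.
Qed.

Lemma cut_fuel n rho : rb ^+ n < rho -> cut rho = cutn n rho.
Proof.
move=> nrho; rewrite /cut; case: xgetP => [k _ /= st|/(_ n)/= []].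
  by rewrite -(st (maxn n k)) ?leq_maxr// (cutn_stable nrho) ?leq_maxl.
by move=> m; exact: cutn_stable.
Qed.

Lemma cutE rho : 0 < rho -> cut rho =
  if 1 < rho then [:: [::]]
  else [seq i :: v | i <- enum 'I_N, v <- cut (rho / r i)].
Proof.
move=> /exists_fuel[n nrho].
rewrite (@cut_fuel n.+1) /=; last first.
  by rewrite exprS (le_lt_trans _ nrho)// ler_piMl ?exprn_ge0 ?ltW.
case: ifPn => // _; congr flatten.
apply: eq_map => i; rewrite (@cut_fuel n)// (lt_le_trans nrho)//.
rewrite ler_pdivlMr// ler_piMr// ?(ltW (lt_trans _ nrho)) ?exprn_gt0//.
by case/andP: (hr i) => _ /le_trans; apply; exact: ltW.
Qed.

(** Induction along the stopping recursion: the scale grows by a factor at each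
    letter until it exceeds [1]. *)
Lemma cut_ind (P : R -> seq word -> Prop) :
  (forall rho, 1 < rho -> P rho [:: [::]]) ->
  (forall rho, 0 < rho -> rho <= 1 -> (forall i, P (rho / r i) (cut (rho / r i))) ->
    P rho [seq i :: v | i <- enum 'I_N, v <- cut (rho / r i)]) ->
  forall rho, 0 < rho -> P rho (cut rho).
Proof.
move=> P1 PS rho rho0; have [n] := exists_fuel rho0.
elim: n rho rho0 => [|n IH] rho rho0 nrho.
  by move: nrho; rewrite expr0 cutE// => h; rewrite h; exact: P1.
rewrite cutE//; case: ltP => h; first exact: P1.
apply: PS => // i; apply: IH; first by rewrite divr_gt0.
rewrite ltr_pdivlMr// mulrC; apply: le_lt_trans nrho.
by rewrite exprS ler_wpM2r ?exprn_ge0 ?(ltW rb0)//; case/andP: (hr i).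
Qed.

Lemma cut_ratio rho v : 0 < rho -> v \in cut rho ->
  wprod r v < rho /\ (if 1 < rho then 1 <= wprod r v else ra * rho <= wprod r v).
Proof.
move=> rho0; move: rho rho0 v.
apply: (@cut_ind (fun rho s => forall v, v \in s -> wprod r v < rho /\
  (if 1 < rho then 1 <= wprod r v else ra * rho <= wprod r v))) => rho.
  by move=> rho1 v; rewrite inE => /eqP ->; rewrite wprod_nil rho1.
move=> rho0 rho1 IH v /allpairsPdep[i [w [_ /IH[wi iw] ->]]].
rewrite wprod_cons (le_gtF rho1); split; first by rewrite mulrC -ltr_pdivlMr.
move: iw; case: ltP => irho.
  move=> w1; apply: (@le_trans _ _ (ra * 1)); first by rewrite ler_pM2l.
  by rewrite ler_pM ?ler01 ?(ltW ra0)//; case/andP: (hr i).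
by rewrite mulrA ler_pdivrMr// mulrC [r i * _]mulrC.
Qed.

Lemma cut_lt rho v : 0 < rho -> v \in cut rho -> wprod r v < rho.
Proof. by move=> rho0 /(cut_ratio rho0)[]. Qed.

Lemma cut_ge rho v : 0 < rho -> rho <= 1 -> v \in cut rho ->
  ra * rho <= wprod r v.
Proof. by move=> rho0 rho1 /(cut_ratio rho0)[_]; rewrite (le_gtF rho1). Qed.

Lemma cut_uniq rho : 0 < rho -> uniq (cut rho).
Proof.
move: rho; apply: (@cut_ind (fun _ s => uniq s)) => // rho rho0 _ IH.
apply: allpairs_uniq_dep; [exact: enum_uniq| by move=> i _; exact: IH|].
by move=> [i v] [j w] _ _ /= [-> ->].
Qed.

Lemma cut_prefix_free rho : 0 < rho -> prefix_free (cut rho).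
Proof.
move: rho; apply: (@cut_ind (fun _ s => prefix_free s)) => rho.
  by move=> _ v w; rewrite !inE => /eqP -> /eqP ->.
move=> rho0 _ IH v w /allpairsPdep[i [v' [_ hv ->]]] /allpairsPdep[j [w' [_ hw ->]]].
rewrite prefix_cons => /andP[/eqP ij]; rewrite -ij in hw *.
by move=> /(IH i v' w' hv hw) ->.
Qed.

Lemma cut_cover rho w : 0 < rho -> wprod r w < rho ->
  exists2 v, v \in cut rho & prefix v w.
Proof.
move=> rho0; move: rho rho0 w.
apply: (@cut_ind (fun rho s => forall w, wprod r w < rho ->
  exists2 v, v \in s & prefix v w)) => rho.
  by move=> _ w _; exists [::]; rewrite ?inE ?prefix0s.
move=> rho0 rho1 IH [|i w]; first by rewrite wprod_nil ltNge rho1.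
rewrite wprod_cons mulrC -ltr_pdivlMr// => /IH[v hv vw].
exists (i :: v); last by rewrite prefix_cons eqxx.
by apply/allpairsPdep; exists i, v; rewrite mem_enum.
Qed.

(** The stopping family is self-similar: below [v] it looks like the stopping
    family at the rescaled threshold. *)
Lemma cat_cut v w rho : 0 < rho -> rho <= 1 -> w \in cut rho ->
  v ++ w \in cut (wprod r v * rho).
Proof.
move=> rho0 rho1 wr; elim: v => [|i v IH]; first by rewrite wprod_nil mul1r.
have v0 : 0 < wprod r v by exact: wprod_gt0.
have -> : wprod r (i :: v) * rho = r i * (wprod r v * rho).
  by rewrite wprod_cons mulrA.
have v1 : wprod r v <= 1.
  apply: (@le_trans _ _ (rb ^+ size v)); last by rewrite exprn_ile1 ?ltW.
  by apply: wprod_le_exp => k; case/andP: (hr k) => _ ->; rewrite ltW.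
rewrite cutE ?mulr_gt0// ifF; last first.
  apply: le_gtF; rewrite mulr_ile1 ?mulr_ge0 ?mulr_ile1 ?(ltW v0) ?(ltW rho0)//.
    exact: ltW.
  by case/andP: (hr i) => _ /le_trans; apply; exact: ltW.
apply/allpairsPdep; exists i, (v ++ w); rewrite mem_enum; split => //.
by rewrite mulrC mulKf// gt_eqF.
Qed.

Lemma sum_cut (p : 'I_N -> R) rho : \sum_i p i = 1 -> 0 < rho ->
  \sum_(v <- cut rho) wprod p v = 1.
Proof.
move=> p1; move: rho.
apply: (@cut_ind (fun _ s => \sum_(v <- s) wprod p v = 1)) => rho.
  by rewrite big_seq1 wprod_nil.
move=> _ _ IH; rewrite big_allpairs_dep/= -[RHS]p1 big_enum/=.
apply: eq_bigr => i _; under eq_bigr do rewrite wprod_cons.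
by rewrite -mulr_sumr IH mulr1.
Qed.

(** The words of the stopping family that pass through [j] carry mass [p_j], or
    none at all when the family stops before [j]. *)
Lemma sum_cut_prefix (p : 'I_N -> R) j rho : (forall i, 0 < p i) ->
  \sum_i p i = 1 -> 0 < rho ->
  \sum_(v <- cut rho | prefix j v) wprod p v <= wprod p j.
Proof.
move=> p0 p1; elim: j rho => [|i j IH] rho rho0.
  rewrite wprod_nil (eq_bigl xpredT) ?sum_cut// => v.
  by rewrite prefix0s.
rewrite (cutE rho0); case: ltP => h.
  by rewrite big_mkcond big_seq1/= ltW// wprod_gt0.
rewrite big_mkcond big_allpairs_dep/= big_enum/= (bigD1 i)//=.
rewrite [X in _ + X]big1 ?addr0; last first.
  move=> k ki; rewrite big1// => v _; by rewrite eq_sym (negbTE ki).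
rewrite eqxx/= -big_mkcond/=.
under eq_bigr do rewrite wprod_cons.
by rewrite -mulr_sumr wprod_cons ler_pM2l// IH// divr_gt0.
Qed.

End Cut.
End Words.

(** * The series over words with quotient near [alpha] *)

Section Zeta.
Variables (R : realType) (N : nat) (r p : 'I_N -> R) (alpha : R).
Notation word := (seq 'I_N).
Implicit Types (v w : word).
Hypotheses (hr : forall i, 0 < r i < 1) (hp : forall i, 0 < p i).

Let r0 i : 0 < r i. Proof. by case/andP: (hr i). Qed.

(** The deviation of the quotient of logarithms from [alpha], multiplied by the
    length so that it adds up under concatenation. *)
Definition excess w : R := nlog p w - alpha * nlog r w.

Lemma excess_cat v w : excess (v ++ w) = excess v + excess w.
Proof. by rewrite /excess !nlog_cat//; ring. Qed.

Lemma nlog_ge_size : exists2 c : R, 0 < c & forall w, c * (size w)%:R <= nlog r w.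
Proof.
have [a [b [a0 ab b1 rab]]] := ratio_bounds hr.
have b0 : 0 < b by exact: lt_le_trans ab.
exists (- ln b); first by rewrite oppr_gt0 ln_lt0// b0.
move=> w; rewrite /nlog mulNr lerN2 mulr_natr -lnXn//.
rewrite ler_ln ?posrE ?exprn_gt0 ?wprod_gt0//.
by apply: wprod_le_exp => i; case/andP: (rab i) => _ ->; rewrite ltW.
Qed.

Lemma nlog_le_size (q : 'I_N -> R) : (forall i, 0 < q i) ->
  exists2 c : R, 0 < c & forall w, nlog q w <= c * (size w)%:R.
Proof.
move=> q0; exists (1 + \sum_i `|ln (q i)|).
  by rewrite ltr_pwDl// sumr_ge0.
elim=> [|i w IH]; first by rewrite nlog_nil mulr0.
rewrite -cat1s nlog_cat// -natr1 mulrDr mulr1 addrC lerD//.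
rewrite /nlog /wprod big_seq1 (le_trans (ler_norm _))// normrN.
rewrite (bigD1 i)//= addrCA lerDl addr_ge0// sumr_ge0// => j _; exact: normr_ge0.
Qed.

Lemma nlog_gt0 w : w <> [::] -> 0 < nlog r w.
Proof.
have [c c0 cw] := nlog_ge_size; move=> w0; apply: lt_le_trans (cw w).
by rewrite mulr_gt0// ltr0n; case: w w0.
Qed.

Lemma nlog_ge0 w : 0 <= nlog r w.
Proof.
have [c c0 cw] := nlog_ge_size; apply: le_trans (cw w).
by rewrite mulr_ge0// ltW.
Qed.

Lemma zeta_sim_indexE rho w :
  zeta_sim_index r p alpha rho w <->
  w <> [::] /\ `|excess w| <= rho * nlog r w.
Proof.
have E : w <> [::] -> `|excess w| =
    `|ln (wprod p w) / ln (wprod r w) - alpha| * nlog r w.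
  move=> /nlog_gt0 w0; rewrite -[X in _ * X]gtr0_norm// -normrM; congr `|_|.
  rewrite /excess /nlog; field.
  by rewrite -oppr_eq0 gt_eqF.
rewrite /zeta_sim_index/=.
by split => -[w0 h]; split => //; move: h; rewrite E// ler_pM2r// nlog_gt0.
Qed.

Lemma powR_split w (s t : R) : wprod r w `^ s = wprod r w `^ t * expR ((t - s) * nlog r w).
Proof. by rewrite !powR_nlog// -expRD; congr expR; ring. Qed.

Lemma sum_le_esum (T : choiceType) (W : set T) (f : T -> R) (s : seq T) :
  uniq s -> (forall x, x \in s -> W x) -> (forall x, 0 <= f x) ->
  ((\sum_(x <- s) f x)%:E <= \esum_(x in W) (f x)%:E)%E.
Proof.
move=> us sW f0. apply: esum_ge; exists [set` s].
  by split => //; exact: finite_seq.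
by rewrite -fsbig_seq// sumEFin.
Qed.

Lemma esum_le_sum (T : choiceType) (W : set T) (f : T -> R) (M : R) :
  (forall s : seq T, uniq s -> (forall x, x \in s -> W x) ->
     \sum_(x <- s) f x <= M) ->
  (\esum_(x in W) (f x)%:E <= M%:E)%E.
Proof.
move=> h; apply: ge_ereal_sup => _ [X [fX XW] <-].
have [s0 XE] := (finite_seqP X).1 fX.
have {}XE : X = [set` undup s0].
  by rewrite XE; apply/seteqP; split => x /=; rewrite mem_undup.
rewrite XE -fsbig_seq ?undup_uniq// sumEFin lee_fin; apply: h => [|x xs].
  exact: undup_uniq.
by apply: XW; rewrite XE.
Qed.

(** If the weight carried by the words of length [n] stayed below [1] for the
    exponent [t - e], then for the exponent [t] it would decay geometrically
    in [n], and the series would converge. *)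
Lemma summable_of_levels (W : set word) (t e : R) (n0 : nat) : 0 < e ->
  (forall n, (n0 <= n)%N ->
     \sum_(w <- level N n | `[< W w >]) wprod r w `^ (t - e) <= 1) ->
  summable W (fun w => (wprod r w `^ t)%:E).
Proof.
move=> e0 hn; have [c c0 hc] := nlog_ge_size.
pose q := expR (- (e * c)).
have q0 : 0 < q by exact: expR_gt0.
have q1 : q < 1 by rewrite expR_lt1 oppr_lt0 mulr_gt0.
pose lev n := \sum_(w <- level N n | `[< W w >]) wprod r w `^ t.
have lev0 n : 0 <= lev n by apply: sumr_ge0 => w _; exact: powR_ge0.
have levq n : (n0 <= n)%N -> lev n <= q ^+ n.
  move=> nn; rewrite -[leRHS]mul1r; apply: le_trans (ler_wpM2r _ (hn n nn)).
    rewrite mulr_suml /lev big_seq_cond [leRHS]big_seq_cond ler_sum// => w.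
    rewrite mem_level => /andP[/eqP wn _].
    rewrite (powR_split w t (t - e)) ler_wpM2l ?powR_ge0//.
    rewrite /q -expRM_natl ler_expR.
    have := hc w; rewrite wn => h.
    have := ler_wpM2l (ltW e0) h; lra.
  by rewrite exprn_ge0 ?ltW.
pose C := 1 + \sum_(i < n0) lev i / q ^+ i.
have levC n : lev n <= C * q ^+ n.
  have [nn|nn] := leqP n0 n.
    apply: le_trans (levq n nn) _; rewrite ler_peMl ?exprn_ge0 ?(ltW q0)// lerDl.
    by apply: sumr_ge0 => i _; rewrite divr_ge0 ?exprn_ge0// ltW.
  rewrite -ler_pdivrMr ?exprn_gt0// /C (bigD1 (Ordinal nn))//= addrCA lerDl.
  rewrite addr_ge0// sumr_ge0// => i _; rewrite divr_ge0 ?exprn_ge0// ltW//.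
have C0 : 0 <= C.
  rewrite addr_ge0// sumr_ge0// => i _; rewrite divr_ge0 ?exprn_ge0// ltW//.
rewrite /summable.
under eq_esum do rewrite gee0_abs ?lee_fin ?powR_ge0//.
apply: (@le_lt_trans _ _ (C / (1 - q))%:E); last exact: ltry.
apply: esum_le_sum => s us sW.
pose K := (\max_(w <- s) size w).+1.
pose S := [seq w <- [seq w | n <- iota 0 K, w <- level N n] | `[< W w >]].
apply: (@le_trans _ _ (\sum_(w <- S) wprod r w `^ t)).
  apply: ler_sum_subset => //.
  - apply: filter_uniq; apply: allpairs_uniq_dep; first exact: iota_uniq.
      by move=> n _; exact: level_uniq.
    move=> [n v] [m w] /allpairsPdep[n1 [v1 [_ hv [-> ->]]]].
    move=> /allpairsPdep[m1 [w1 [_ hw [-> ->]]]] /= vw.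
    by move: hv hw; rewrite vw !mem_level => /eqP -> /eqP ->.
  - move=> w ws; rewrite mem_filter; apply/andP; split; first exact/asboolP/sW.
    apply/allpairsPdep; exists (size w), w; rewrite mem_level eqxx; split => //.
    by rewrite mem_iota/= add0n ltnS leq_bigmax_seq.
  - by move=> w; exact: powR_ge0.
rewrite big_filter big_mkcond big_allpairs_dep/=.
apply: (@le_trans _ _ (\sum_(n <- iota 0 K) C * q ^+ n)).
  by apply: ler_sum => n _; rewrite -big_mkcond; exact: levC.
rewrite -mulr_sumr ler_wpM2l// -[iota 0 K]/(index_iota 0 K) big_mkord.
have := subrXX 1 q K; rewrite expr1n.
under eq_bigr do rewrite expr1n mul1r.
move=> h; rewrite -[leRHS]mul1r ler_pdivlMr ?subr_gt0// mulrC -h.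
by rewrite gerBl exprn_ge0// ltW.
Qed.

(** Below the abscissa the levels stay heavy: the form in which divergence of
    the series supplies blocks of words. *)
Lemma abscissa_lt_levels rho (t e : R) n0 : 0 < e ->
  (t%:E < sigma_ab_zeta_sim r p alpha rho)%E ->
  exists2 n, (n0 <= n)%N &
    1 <= \sum_(w <- level N n | `[< zeta_sim_index r p alpha rho w >])
           wprod r w `^ (t - e).
Proof.
move=> e0 ts; apply: contrapT => hn.
suff : summable (zeta_sim_index r p alpha rho) (fun w => (wprod r w `^ t)%:E).
  move=> st; move: ts; rewrite ltNge => /negP; apply.
  by apply: ereal_inf_lbound; exists t.
apply: (summable_of_levels (n0 := n0) e0) => n nn; apply/ltW; rewrite ltNge.
by apply/negP => h; apply: hn; exists n.
Qed.

End Zeta.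

(** * Adaptive concatenation of words *)

Section Mixing.
Variables (R : realType) (N : nat) (r p : 'I_N -> R) (alpha : R).
Notation word := (seq 'I_N).
Implicit Types (v w g : word).
Hypotheses (hr : forall i, 0 < r i < 1) (hp : forall i, 0 < p i).
Variables (A B : seq word).

Let r0 i : 0 < r i. Proof. by case/andP: (hr i). Qed.
Let X := excess r p alpha.
Let L := nlog r.

Fixpoint mix m : seq word :=
  if m is m'.+1 then
    [seq g ++ a | g <- mix m', a <- if X g <= 0 then A else B]
  else [:: [::]].

Hypotheses (uA : uniq A) (uB : uniq B) (pA : prefix_free A) (pB : prefix_free B).

(** Which family extends [g] depends only on [g], so prefix-freeness is
    inherited as for a product of two codes. *)
Lemma mix_prefix_free m : uniq (mix m) /\ prefix_free (mix m).
Proof.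
elim: m => [|m [um pm]] /=.
  by split=> // v w; rewrite !inE => /eqP -> /eqP ->.
set S := fun g => if X g <= 0 then A else B.
have uS g : uniq (S g) by rewrite /S; case: ifP.
have pS g : prefix_free (S g) by rewrite /S; case: ifP.
have key g g' a a' : g \in mix m -> g' \in mix m -> a \in S g -> a' \in S g' ->
    prefix (g ++ a) (g' ++ a') -> g = g' /\ a = a'.
  move=> gm gm' ag ag' pf.
  have gg' : g = g'.
    have p1 : prefix g (g' ++ a') by apply: prefix_trans pf; exact: prefix_prefix.
    have p2 : prefix g' (g' ++ a') by exact: prefix_prefix.
    have [s|s] := leqP (size g) (size g').
      by apply: pm => //; exact: (prefix_comparable p1 p2 s).
    by apply/esym/pm => //; exact: (prefix_comparable p2 p1 (ltnW s)).
  split => //; rewrite -gg' in ag' pf; apply: (pS g) => //.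
  by move: pf; rewrite prefix_catr// eqxx.
split.
  apply: allpairs_uniq_dep; [exact: um|by move=> g _; exact: uS|].
  move=> [g a] [g' a'] /=.
  move=> /allpairsPdep[x [y [xm yS [-> ->]]]] /allpairsPdep[x' [y' [xm' yS' [-> ->]]]].
  move=> /= E; have [] := key _ _ _ _ xm xm' yS yS'; last by move=> -> ->.
  by rewrite E; exact: prefix_refl.
move=> v w /allpairsPdep[g [a [gm aS ->]]] /allpairsPdep[g' [a' [gm' aS' ->]]].
by move=> /(key _ _ _ _ gm gm' aS aS')[-> ->].
Qed.

Hypotheses (nA : [::] \notin A) (nB : [::] \notin B).

Lemma mix_size m g : g \in mix m -> (m <= size g)%N.
Proof.
elim: m g => // m IH w /= /allpairsPdep[g [a [gm aS ->]]].
rewrite size_cat -addn1 leq_add ?IH//.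
by case: a aS => //; case: ifP => _; rewrite ?(negbTE nA) ?(negbTE nB).
Qed.

Variables (c C : R).
Hypotheses (c0 : 0 <= c)
  (XA : forall w, w \in A -> - (c * L w) <= X w <= C)
  (XB : forall w, w \in B -> - C <= X w <= c * L w).

(** The excess is pushed back as soon as it has the wrong sign, so apart from the
    tolerated drift it never exceeds the contribution [C] of a single word. *)
Lemma mix_excess m g : 0 <= C -> g \in mix m -> `|X g| <= C + c * L g.
Proof.
move=> C0; elim: m g => [|m IH] w /=.
  rewrite inE => /eqP ->; rewrite /X /L /excess !nlog_nil !mulr0 subr0 addr0.
  by rewrite normr0.
move=> /allpairsPdep[g [a [/IH gm aS ->]]].
have cg : 0 <= c * L g by rewrite mulr_ge0// nlog_ge0.
have ca : 0 <= c * L a by rewrite mulr_ge0// nlog_ge0.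
rewrite /X excess_cat// /L nlog_cat// mulrDr.
move: gm; rewrite !ler_norml -/X -/L => /andP[g1 g2].
move: aS; case: (leP (X g) 0) => Xg.
  by move=> /XA/andP[h1 h2]; apply/andP; split; lra.
by move=> /XB/andP[h1 h2]; apply/andP; split; lra.
Qed.

Variable t : R.
Hypotheses (sA : 1 <= \sum_(w <- A) wprod r w `^ t)
  (sB : 1 <= \sum_(w <- B) wprod r w `^ t).

Lemma mix_sum m : 1 <= \sum_(w <- mix m) wprod r w `^ t.
Proof.
elim: m => [|m IH] /=; first by rewrite big_seq1 wprod_nil powR1.
apply: (le_trans IH); rewrite big_allpairs_dep/= ler_sum// => g _.
under eq_bigr do rewrite wprod_cat powRM ?ltW ?wprod_gt0//.
by rewrite -mulr_sumr ler_peMr ?powR_ge0//; case: ifP.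
Qed.

End Mixing.

Lemma archimedean_mul (R : realType) (b a : R) : 0 < a ->
  exists m0, forall m, (m0 <= m)%N -> b <= a * m%:R.
Proof.
move=> a0; exists (Num.truncn (b / a)).+1 => m hm; rewrite -ler_pdivrMl// mulrC.
by rewrite (le_trans (ltW (truncnS_gt _)))// ler_nat.
Qed.

(** Words of two prefix-free families, one whose logarithmic quotients are
    almost at least [alpha] and one whose quotients are almost at most [alpha],
    can be concatenated adaptively, always correcting the sign of the current
    excess.  All long words produced have quotient within [rho] of [alpha], and
    they still carry total weight at least [1]: this is how concavity enters. *)
Lemma mixing_le_abscissa (R : realType) (N : nat) (r p : 'I_N -> R)
    (alpha c rho t : R) (A B : seq (seq 'I_N)) :
  (forall i, 0 < r i < 1) -> (forall i, 0 < p i) -> 0 <= c -> c < rho ->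
  uniq A -> uniq B -> prefix_free A -> prefix_free B ->
  [::] \notin A -> [::] \notin B ->
  (forall w, w \in A -> - (c * nlog r w) <= excess r p alpha w) ->
  (forall w, w \in B -> excess r p alpha w <= c * nlog r w) ->
  1 <= \sum_(w <- A) wprod r w `^ t -> 1 <= \sum_(w <- B) wprod r w `^ t ->
  (t%:E <= sigma_ab_zeta_sim r p alpha rho)%E.
Proof.
move=> hr hp c0 crho uA uB pA pB nA nB XA XB sA sB.
(* a crude common bound for the excess of a single word *)
pose C := \sum_(w <- A ++ B) `|excess r p alpha w|.
have C0 : 0 <= C by exact: sumr_ge0.
have CE w : w \in A ++ B -> `|excess r p alpha w| <= C.
  move=> wAB; rewrite /C (perm_big _ (perm_to_rem wAB)) big_cons lerDl.
  exact: sumr_ge0.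
have [k k0 hk] := nlog_ge_size hr.
apply: le_ereal_inf_tmp => _ /= [s ss <-]; rewrite lee_fin leNgt; apply/negP => st.
have mixW m w : C <= (rho - c) * (k * m%:R) -> (0 < m)%N ->
    w \in mix r p alpha A B m -> zeta_sim_index r p alpha rho w.
  move=> Cm m0 wm; have wsize := mix_size nA nB wm.
  apply/(zeta_sim_indexE p alpha hr); split; first by move=> w0; move: wsize m0; rewrite w0; case: m {Cm wm}.
  have -> : rho * nlog r w = (rho - c) * nlog r w + c * nlog r w by ring.
  apply: le_trans (mix_excess (m := m) hr hp c0 _ _ C0 wm) _.
  - move=> v vA; rewrite XA//= (le_trans (ler_norm _))// CE//.
    by rewrite mem_cat vA.
  - move=> v vB; rewrite XB// andbT lerNl (le_trans (ler_norm _))// normrN CE//.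
    by rewrite mem_cat vB orbT.
  rewrite lerD2r (le_trans Cm)// ler_wpM2l ?subr_ge0 ?(ltW crho)//.
  apply: le_trans (hk w); rewrite ler_wpM2l ?ler_nat//.
  exact: ltW.
have r0 i : 0 < r i by case/andP: (hr i).
have lower m : C <= (rho - c) * (k * m%:R) -> (0 < m)%N ->
   (((t - s) * (k * m%:R))%:E <=
     \esum_(w in zeta_sim_index r p alpha rho) `|(wprod r w `^ s)%:E|)%E.
  move=> Cm m0; have [um _] := mix_prefix_free r p alpha uA uB pA pB m.
  under eq_esum do rewrite gee0_abs ?lee_fin ?powR_ge0//.
  apply: le_trans (sum_le_esum um (fun w => @mixW m w Cm m0) (fun w => powR_ge0 _ _)).
  rewrite lee_fin; apply: (@le_trans _ _ (\sum_(w <- mix r p alpha A B m)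
     wprod r w `^ t * ((t - s) * (k * m%:R)))).
    rewrite -mulr_suml ler_peMl ?mulr_ge0 ?subr_ge0 ?(ltW st) ?(ltW k0)//.
    exact: mix_sum.
  rewrite big_seq [leRHS]big_seq ler_sum// => w wm.
  rewrite (powR_split hr w s t) ler_wpM2l ?powR_ge0//.
  apply: le_trans (expR_ge1Dx _); rewrite ler_wpDl// ler_wpM2l ?subr_ge0 ?(ltW st)//.
  apply: le_trans (hk w); rewrite ler_wpM2l ?ler_nat ?(ltW k0)//.
  exact: (mix_size nA nB wm).
move: ss; rewrite /summable.
set E := esum _ _ => Efin.
have E0 : (0 <= E)%E by apply: esum_ge0 => w _; exact: abse_ge0.
have EM : E = (fine E)%:E by rewrite fineK// ge0_fin_numE.
have tsk : 0 < (t - s) * k by rewrite mulr_gt0// subr_gt0.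
have rck : 0 < (rho - c) * k by rewrite mulr_gt0// subr_gt0.
have [m1 h1] := archimedean_mul (fine E + 1) tsk.
have [m2 h2] := archimedean_mul C rck.
pose m := (m1 + m2).+1.
have Cm : C <= (rho - c) * (k * m%:R).
  by rewrite mulrA h2// /m ltnW// ltnS leq_addl.
have := lower m Cm isT; rewrite -/E EM lee_fin mulrA; apply/negP; rewrite -ltNge.
have := h1 m; rewrite /m leqW ?leq_addr// => /(_ isT); apply: lt_le_trans.
by rewrite ltrDl.
Qed.

(** * Pieces of the iterated function system *)

Section IteratedMaps.
Variables (R : realType) (d N : nat) (S : 'I_N -> 'rV[R]_d -> 'rV[R]_d).
Variables (r : 'I_N -> R).
Hypotheses (hr : forall i, 0 < r i < 1) (hS : forall i, is_similarity (S i) (r i)).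
Notation word := (seq 'I_N).
Implicit Types (v w : word).

Let r0 i : 0 < r i. Proof. by case/andP: (hr i). Qed.

Fixpoint Sw w x := if w is i :: w' then S i (Sw w' x) else x.

Lemma Sw_cat v w x : Sw (v ++ w) x = Sw v (Sw w x).
Proof. by elim: v => //= i v ->. Qed.

Lemma Sw_similarity w : is_similarity (Sw w) (wprod r w).
Proof.
elim: w => [|i w IH] x y; first by rewrite wprod_nil mul1r.
by rewrite /= hS IH wprod_cons mulrA.
Qed.

Lemma Sw_inj w : injective (Sw w).
Proof.
have [T [TK _]] := similarity_bij (wprod_gt0 w r0) (Sw_similarity w).
exact: can_inj TK.
Qed.

Lemma Sw_sub (A : set 'rV[R]_d) w x : (forall i, S i @` A `<=` A) ->
  A x -> A (Sw w x).
Proof.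
move=> SA Ax; elim: w => //= i w IH.
by apply: (SA i); exists (Sw w x).
Qed.

(** Incomparable words first differ at some letter; from there on they stay in
    disjoint first-level images of [O]. *)
Lemma Sw_disjoint (O : set 'rV[R]_d) v w x y :
  (forall i, S i @` O `<=` O) ->
  (forall i j, i != j -> (S i @` O) `&` (S j @` O) = set0) ->
  ~~ prefix v w -> ~~ prefix w v -> O x -> O y -> Sw v x <> Sw w y.
Proof.
move=> SO dO + + Ox Oy; elim: v w => [|i v IH] [|j w] //; rewrite ?prefix0s//.
rewrite !prefix_cons [j == i]eq_sym; have [->|ij] := eqVneq i j => /=.
  by move=> vw wv /(@Sw_inj [:: j]); exact: IH.
move=> _ _ E; have : (S i @` O `&` S j @` O) (Sw (i :: v) x).
  split; first by exists (Sw v x) => //; exact: Sw_sub.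
  by rewrite /= E; exists (Sw w y) => //; exact: Sw_sub.
by rewrite dO.
Qed.

End IteratedMaps.

Section SelfSimilarMeasure.
Variables (R : realType) (d N : nat) (S : 'I_N -> 'rV[R]_d -> 'rV[R]_d).
Variables (r p : 'I_N -> R) (mu : probability (borelRd R d) R).
Hypotheses (hr : forall i, 0 < r i < 1) (hS : forall i, is_similarity (S i) (r i)).
Hypotheses (hp : forall i, 0 < p i) (hp1 : \sum_(i < N) p i = 1)
  (hmu : self_similar_measure S p mu).
Notation word := (seq 'I_N).
Implicit Types (v w : word).

Let r0 i : 0 < r i. Proof. by case/andP: (hr i). Qed.

Lemma measurable_preimage_eball i x s :
  measurable (S i @^-1` eball x s : set (borelRd R d)).
Proof.
have [T [_ TK]] := similarity_bij (r0 i) (hS i).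
by rewrite (similarity_preimage_eball _ _ (r0 i) (hS i) TK); exact: measurable_eball.
Qed.

(** Large balls about [o] are mapped by every [S i] well inside themselves, so
    self-similarity forbids mass outside. *)
Lemma exists_invariant_ball o : exists rho0 : R,
  [/\ 0 < rho0, forall i, S i @` eball o rho0 `<=` eball o rho0 &
      mu (eball o rho0) = 1%E].
Proof.
have [a [b [a0 ab b1 rab]]] := ratio_bounds hr.
(* [rho0] solves [b * rho + m0 = rho - 1]: beyond it every [S i] pulls balls in by
   at least [1] *)
pose m0 := \sum_i edist o (S i o).
have m00 : 0 <= m0 by apply: sumr_ge0 => i _; exact: edist_ge0.
have m0i i : edist o (S i o) <= m0.
  by rewrite /m0 (bigD1 i)//= lerDl sumr_ge0// => j _; exact: edist_ge0.
pose rho0 := (m0 + 1) / (1 - b).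
have b10 : 0 < 1 - b by rewrite subr_gt0.
have rho00 : 0 < rho0 by rewrite divr_gt0// ltr_wpDl.
have shrink i rho : rho0 <= rho -> S i @` eball o rho `<=` eball o (rho - 1).
  rewrite ler_pdivrMr// => h _ [y yo <-]; rewrite /eball/=.
  apply: le_trans (edist_triangle (S i o) _ _) _.
  have := m0i i; rewrite hS; have /andP[_ rib] := rab i.
  have := ler_pM (ltW (r0 i)) (edist_ge0 o y) rib yo; nra.
have step rho : rho0 <= rho -> (mu (eball o rho) <= mu (eball o (rho - 1)))%E.
  move=> h; rewrite (hmu (measurable_eball o (rho - 1))).
  rewrite -[leLHS]mul1e -{1}hp1 -sumEFin ge0_sume_distrl; last first.
    by move=> i _; rewrite lee_fin ltW.
  apply: lee_sum => i _; apply: lee_wpmul2l; first by rewrite lee_fin ltW.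
  apply: le_measure; rewrite ?inE.
  - exact: measurable_eball.
  - exact: measurable_preimage_eball.
  - by move=> y yo; apply: (shrink i rho h (S i y)); exists y.
have chain k : (mu (eball o (rho0 + k%:R)) <= mu (eball o rho0))%E.
  elim: k => [|k IH]; first by rewrite addr0.
  apply: le_trans IH; rewrite -natr1 addrA.
  rewrite -[X in (_ <= mu (eball o X))%E](addrK 1); apply: step.
  by rewrite -addrA lerDl addr_ge0.
exists rho0; split => // [i|].
  apply: subset_trans (shrink i rho0 _) _ => // y; rewrite /eball/=; lra.
apply/eqP; rewrite eq_le probability_le1/=; last exact: measurable_eball.
have cvg1 : mu (eball o (rho0 + k%:R)) @[k --> \oo] --> 1%E.
  rewrite -(probability_setT mu).
  have -> : [set: borelRd R d] = \bigcup_k eball o (rho0 + k%:R).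
    apply/esym/seteqP; split => // y _.
    exists (Num.truncn (edist o y)).+1 => //; rewrite /eball/=.
    rewrite (le_trans (ltW (truncnS_gt _)))// lerDr ltW//.
  apply: nondecreasing_cvg_mu.
  - by move=> k; exact: measurable_eball.
  - by apply: bigcup_measurable => k _; exact: measurable_eball.
  - move=> m n mn; apply/subsetPset => y; rewrite /eball/= => /le_trans; apply.
    by rewrite lerD2l ler_nat.
rewrite -(cvg_lim _ cvg1)//; apply: lime_le; first by apply/cvg_ex; exists 1%E.
by apply: nearW => k; exact: chain.
Qed.

Section Ball.
Variables (o : 'rV[R]_d) (rho0 : R).
Hypotheses (rho00 : 0 < rho0) (SD : forall i, S i @` eball o rho0 `<=` eball o rho0)
  (muD : mu (eball o rho0) = 1%E).

(** Following [v] letter by letter, self-similarity gives a set that contains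
    the piece of [v] at least the share [p_v] of the mass of [eball o rho0]. *)
Lemma mu_ge_piece v x s :
  (forall y, eball o rho0 y -> edist x (Sw S v y) <= s) ->
  ((wprod p v)%:E <= mu (eball x s))%E.
Proof.
elim: v x s => [|i v IH] x s h.
  rewrite wprod_nil -muD; apply: le_measure; rewrite ?inE; try exact: measurable_eball.
  by move=> y /h.
rewrite (hmu (measurable_eball x s)) (bigD1 i)//=.
apply: (@le_trans _ _ ((p i)%:E * mu (S i @^-1` eball x s))%E); last first.
  rewrite leeDl//; apply: sume_ge0 => j _.
  by rewrite mule_ge0 ?measure_ge0// lee_fin ltW.
rewrite wprod_cons EFinM; apply: lee_wpmul2l; first by rewrite lee_fin ltW.
have [T [_ TK]] := similarity_bij (r0 i) (hS i).
rewrite (similarity_preimage_eball _ _ (r0 i) (hS i) TK); apply: IH => y /h /=.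
by rewrite ler_pdivlMr// -{1}(TK x) hS mulrC.
Qed.

Definition hits x s v : bool :=
  `[< exists2 y, eball o rho0 y & edist x (Sw S v y) <= s >].

(** Self-similarity unfolded along a stopping family; a piece that misses the
    ball contributes nothing because all the mass lies in [eball o rho0]. *)
Lemma mu_le_hits rho x s : 0 < rho ->
  (mu (eball x s) <= (\sum_(v <- cut r rho | hits x s v) wprod p v)%:E)%E.
Proof.
have [a [b [a0 ab b1 rab]]] := ratio_bounds hr.
move=> rho_gt0; move: rho rho_gt0 x s.
apply: (cut_ind a0 ab b1 rab (P := fun rho V => forall x s,
  (mu (eball x s) <= (\sum_(v <- V | hits x s v) wprod p v)%:E)%E)).
  move=> rho _ x s; rewrite big_mkcond big_seq1 wprod_nil; case: ifPn => h.
    by rewrite probability_le1//; exact: measurable_eball.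
  have mE := measurable_eball x s; have mD := measurable_eball o rho0.
  have dis : eball x s `&` eball o rho0 = set0.
    apply/eqP/negPn/negP => /set0P[y [xy yo]].
    by move/asboolP : h; apply; exists y.
  have mU : mu (eball x s `|` eball o rho0) = (mu (eball x s) + 1)%E.
    by rewrite -muD; exact: measureU.
  have : (mu (eball x s `|` eball o rho0) <= 1)%E.
    by rewrite probability_le1//; exact: measurableU.
  by rewrite mU -[leRHS]add0e leeD2rE.
move=> rho rho_gt0 rho1 IH x s.
rewrite (hmu (measurable_eball x s)) [X in (_ <= X%:E)%E]big_mkcond.
rewrite big_allpairs_dep/= big_enum/=.
rewrite -sumEFin; apply: lee_sum => i _; rewrite -big_mkcond/=.
have [T [_ TK]] := similarity_bij (r0 i) (hS i).
rewrite (similarity_preimage_eball _ _ (r0 i) (hS i) TK).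
apply: (@le_trans _ _ ((p i)%:E *
    (\sum_(v <- cut r (rho / r i) | hits (T x) (s / r i) v) wprod p v)%:E)%E).
  by apply: lee_wpmul2l; [rewrite lee_fin ltW|exact: IH].
rewrite -EFinM lee_fin mulr_sumr le_eqVlt; apply/orP; left; apply/eqP.
apply: eq_big => v; last by rewrite wprod_cons.
have E y : (edist (T x) (Sw S v y) <= s / r i) = (edist x (S i (Sw S v y)) <= s).
  by rewrite ler_pdivlMr// -{2}(TK x) hS mulrC.
by rewrite /hits; apply/asboolP/asboolP => -[y yo ys]; exists y => //=;
  rewrite ?E// -E.
Qed.

End Ball.
End SelfSimilarMeasure.

(** * Consequences of the open set condition *)

Section OpenSetCondition.
Variables (R : realType) (d N : nat) (S : 'I_N -> 'rV[R]_d -> 'rV[R]_d).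
Variables (r p : 'I_N -> R) (mu : probability (borelRd R d) R).
Hypotheses (hd : (0 < d)%N).
Hypotheses (hr : forall i, 0 < r i < 1) (hS : forall i, is_similarity (S i) (r i)).
Hypotheses (hp : forall i, 0 < p i) (hp1 : \sum_(i < N) p i = 1)
  (hmu : self_similar_measure S p mu).
Variables (O : set 'rV[R]_d) (o : 'rV[R]_d) (c rho0 : R).
Hypotheses (c0 : 0 < c) (oO : eball o c `<=` O) (SO : forall i, S i @` O `<=` O)
  (dO : forall i j, i != j -> (S i @` O) `&` (S j @` O) = set0).
Hypotheses (rho00 : 0 < rho0) (muD : mu (eball o rho0) = 1%E).
Notation word := (seq 'I_N).
Implicit Types (v w : word).

Let r0 i : 0 < r i. Proof. by case/andP: (hr i). Qed.

Lemma wprod_le1 w : wprod r w <= 1.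
Proof.
apply: (@le_trans _ _ (1 ^+ size w)); last by rewrite expr1n.
by apply: wprod_le_exp => i; case/andP: (hr i) => h1 h2; rewrite !ltW.
Qed.

(** If the images of [o] were closer, one of them would lie in the image of [O]
    under the other word, against disjointness. *)
Lemma cut_separated (a b rho : R) v w :
  0 < a -> a <= b -> b < 1 -> (forall i, a <= r i <= b) ->
  0 < rho -> rho <= 1 -> v \in cut r rho -> w \in cut r rho -> v != w ->
  c * a * rho <= edist (Sw S v o) (Sw S w o).
Proof.
move=> a0 ab b1 rab rho_gt0 rho1 vr wr vw; rewrite leNgt; apply/negP => h.
have pf := cut_prefix_free a0 ab b1 rab rho_gt0.
have v0 : 0 < wprod r v by exact: wprod_gt0.
have [T [_ TK]] := similarity_bij v0 (Sw_similarity hS v).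
have Oo : O o by apply: oO; apply: eball_center; exact: ltW.
apply: (@Sw_disjoint _ _ _ S r hr hS O v w (T (Sw S w o)) o) => //.
- by apply: contra vw => /(pf _ _ vr wr) ->.
- by apply: contra vw => /(pf _ _ wr vr) ->.
- apply: oO; rewrite /eball/= -(ler_pM2l v0) -(Sw_similarity hS) TK.
  rewrite (le_trans (ltW h))// [leRHS]mulrC -mulrA ler_pM2l//.
  exact: (cut_ge a0 ab b1 rab).
Qed.

(** Pieces of size comparable to [rho] contain disjoint balls of comparable
    size, so boundedly many of them come near a given point. *)
Lemma bounded_overlap (C : R) : 0 < C ->
  exists M : nat, forall rho x, 0 < rho -> rho <= 1 ->
    (count (hits S o rho0 x (C * rho)%R) (cut r rho) <= M)%N.
Proof.
have [a [b [a0 ab b1 rab]]] := ratio_bounds hr.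
move=> C0; have ca : 0 < c * a by rewrite mulr_gt0.
have [M hM] := @card_separated R d (c * a) (C + rho0) hd ca (addr_gt0 C0 rho00).
exists M => rho x rho_gt0 rho1; rewrite -size_filter.
set s := (X in size X).
have us : uniq s by apply/filter_uniq/(cut_uniq a0 ab b1 rab rho_gt0).
rewrite -[size s]card_ord.
apply: (hM x rho 'I_(size s) (fun i => Sw S (nth [::] s i) o)) => // [i|i j ij].
  have /(mem_nth [::]) := ltn_ord i.
  rewrite mem_filter => /andP[/asboolP[y yo xy] ir].
  rewrite edistC; apply: (le_trans (edist_triangle (Sw S (nth [::] s i) y) _ _)).
  rewrite mulrDl lerD//.
  rewrite (Sw_similarity hS) mulrC ler_pM ?edist_ge0//.
  - by rewrite ltW// wprod_gt0.
  - by rewrite edistC.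
  - by rewrite ltW// (cut_lt a0 ab b1 rab rho_gt0).
have inr (k : 'I_(size s)) : nth [::] s k \in cut r rho.
  by have := mem_nth [::] (ltn_ord k); rewrite mem_filter => /andP[].
apply: (cut_separated a0 ab b1 rab) => //.
by rewrite nth_uniq.
Qed.

Definition near w v : bool :=
  `[< exists a b, [/\ eball o rho0 a, eball o rho0 b &
        edist (Sw S w a) (Sw S v b) <= wprod r w] >].

(** All distances and sizes are scaled by the same factor [r_j]. *)
Lemma near_cat j w v : near (j ++ w) (j ++ v) = near w v.
Proof.
have j0 : 0 < wprod r j by exact: wprod_gt0.
have E a b : (edist (Sw S (j ++ w) a) (Sw S (j ++ v) b) <= wprod r (j ++ w)) =
    (edist (Sw S w a) (Sw S v b) <= wprod r w).
  by rewrite !Sw_cat (Sw_similarity hS) wprod_cat ler_pM2l.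
by apply/asboolP/asboolP => -[a [b [ao bo ab]]]; exists a, b; split => //;
  rewrite ?E// -E.
Qed.

(** A word [u] with the largest possible number of neighbours of its own size:
    prefixing it by [j] preserves these neighbours, so by maximality it cannot
    create others.  Hence all neighbours of the piece of [j ++ u] lie in the
    piece of [j]. *)
Lemma exists_isolated_word : exists u : word, forall j v,
  v \in cut r (wprod r (j ++ u)) -> near (j ++ u) v -> prefix j v.
Proof.
have [a [b [a0 ab b1 rab]]] := ratio_bounds hr.
have w0 w : 0 < wprod r w by exact: wprod_gt0.
have [M hM] := bounded_overlap (addr_gt0 ltr01 rho00).
pose nn w := count (near w) (cut r (wprod r w)).
have nnM w : (nn w <= M)%N.
  apply: leq_trans (hM (wprod r w) (Sw S w o) (w0 w) (wprod_le1 w)).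
  apply: sub_count => v /asboolP[x [y [xo yo xy]]]; apply/asboolP; exists y => //.
  apply: (le_trans (edist_triangle (Sw S w x) _ _)).
  rewrite (Sw_similarity hS) [leRHS]mulrC mulrDr mulr1 addrC lerD//.
  by rewrite ler_wpM2l// ltW.
have [n [u hu] maxn] : exists2 n, exists u, nn u = n &
    forall w, (nn w <= n)%N.
  have ex0 : exists n, `[< exists u, nn u = n >] by exists (nn [::]); apply/asboolP; exists [::].
  have exM n : `[< exists u, nn u = n >] -> (n <= M)%N by move=> /asboolP[u <-].
  case: (ex_maxnP ex0 exM) => n /asboolP[u hu] hn; exists n; first by exists u.
  by move=> w; apply: hn; apply/asboolP; exists w.
exists u => j v vc vn.
(* [s1] are the neighbours of [u] carried below [j], [s2] all neighbours of
   [j ++ u] *)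
pose s1 := [seq j ++ w | w <- [seq w <- cut r (wprod r u) | near u w]].
pose s2 := [seq w <- cut r (wprod r (j ++ u)) | near (j ++ u) w].
have us1 : uniq s1.
  rewrite map_inj_uniq; first exact/filter_uniq/(cut_uniq a0 ab b1 rab).
  by move=> x y /eqP; rewrite eqseq_cat// => /andP[_ /eqP].
have s12 : {subset s1 <= s2}.
  move=> _ /mapP[w + ->]; rewrite !mem_filter near_cat => /andP[-> wc] /=.
  by rewrite wprod_cat; apply: (cat_cut a0 ab b1 rab) => //; exact: wprod_le1.
have [|_ E] := uniq_min_size us1 s12.
  by rewrite size_map !size_filter -/(nn u) -/(nn (j ++ u)) hu.
have : v \in s2 by rewrite mem_filter vn.
by rewrite -E => /mapP[w _ ->]; exact: prefix_prefix.
Qed.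

(** All neighbours of the piece of [j ++ u] pass through [j], so the ball receives
    mass only from words below [j]. *)
Lemma mu_isolated_ball u j x : (forall j v,
    v \in cut r (wprod r (j ++ u)) -> near (j ++ u) v -> prefix j v) ->
  eball o rho0 x ->
  (mu (eball (Sw S (j ++ u) x) (wprod r (j ++ u))) <= (wprod p j)%:E)%E.
Proof.
have [a [b [a0 ab b1 rab]]] := ratio_bounds hr.
move=> hu xo; have w0 : 0 < wprod r (j ++ u) by exact: wprod_gt0.
have := mu_le_hits hr hS hp hmu muD (Sw S (j ++ u) x) (wprod r (j ++ u)) w0.
move=> /le_trans; apply.
rewrite lee_fin; apply: le_trans (sum_cut_prefix a0 ab b1 rab j hp hp1 w0).
rewrite big_mkcond [leRHS]big_mkcond/= big_seq [leRHS]big_seq.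
apply: ler_sum => v vc; case: ifPn => [/asboolP[y yo xy]|_].
  by rewrite (hu j v vc)//; apply/asboolP; exists x, y.
by case: ifP => // _; rewrite ltW// wprod_gt0.
Qed.

End OpenSetCondition.

(** * Hausdorff null sets *)

(** Inequalities between spectra, which may be infinite, are reduced to real
    lower bounds. *)
Lemma lee_lt_real (R : realType) (x y : \bar R) :
  (forall t : R, (t%:E < x)%E -> (t%:E <= y)%E) -> (x <= y)%E.
Proof.
move=> h; rewrite leNgt; apply/negP => yx.
have [t yt tx] : exists2 t : R, (y < t%:E)%E & (t%:E < x)%E.
  case: y x yx {h} => [y| |] [x| |] //=; rewrite ?lte_fin.
  - by move=> yx; exists ((y + x) / 2); rewrite lte_fin; lra.
  - by move=> _; exists (y + 1); rewrite ?ltry// lte_fin; lra.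
  - by move=> _; exists (x - 1); rewrite ?ltNyr// lte_fin; lra.
  - by move=> _; exists 0; rewrite ?ltry ?ltNyr.
by have := h t tx; rewrite leNgt yt.
Qed.

Lemma lt_real_between (R : realType) (t : R) (x : \bar R) : (t%:E < x)%E ->
  exists2 s : R, t < s & (s%:E < x)%E.
Proof.
case: x => [y| |]//; rewrite ?lte_fin.
  by move=> ty; exists ((t + y) / 2); rewrite ?lte_fin; lra.
by move=> _; exists (t + 1); rewrite ?ltry//; lra.
Qed.

Lemma nbhs0_rightP (R : realType) (P : set R) :
  (0^'+ P) <-> exists2 e : R, 0 < e & forall x, 0 < x -> x < e -> P x.
Proof.
split=> [[e /= e0 h]|[e e0 h]].
  exists e => // x x0 xe; apply: h => //=.
  by rewrite sub0r normrN gtr0_norm.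
exists e => // x /=; rewrite sub0r normrN => xe x0; apply: h => //.
by move: xe; rewrite gtr0_norm.
Qed.

Lemma nneseries_le (R : realType) (f : nat -> \bar R) (B : \bar R) :
  (forall n, (0 <= f n)%E) -> (forall n, (\sum_(0 <= k < n) f k <= B)%E) ->
  (\sum_(0 <= k <oo) f k <= B)%E.
Proof.
move=> f0 fB; apply: lime_le; first exact: is_cvg_nneseries.
by apply: nearW => n; exact: fB.
Qed.

Section Hausdorff.
Variables (R : realType) (d : nat).
Implicit Types (A E U : set 'rV[R]_d).

Lemma diam_ge0 (U : set 'rV[R]_d) x : U x -> (0 <= diam U)%E.
Proof.
move=> Ux; apply: ereal_sup_ubound; exists (x, x) => //=.
by rewrite edistxx.
Qed.

Lemma edist_le_diam (U : set 'rV[R]_d) x y : U x -> U y -> ((edist x y)%:E <= diam U)%E.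
Proof. by move=> Ux Uy; apply: ereal_sup_ubound; exists (x, y). Qed.

Lemma diam_eball (x : 'rV[R]_d) (s : R) : (diam (eball x s) <= (2 * s)%:E)%E.
Proof.
apply: ge_ereal_sup => _ [[y z] [/= xy xz] <-]; rewrite lee_fin.
apply: (le_trans (edist_triangle x _ _)); rewrite edistC.
by rewrite /eball/= in xy xz; lra.
Qed.

Lemma gauge_ge0 s U : (0 <= gauge s U)%E.
Proof. by rewrite /gauge; case: ifP => // _; exact: poweR_ge0. Qed.

Lemma gauge_set0 s : gauge s (set0 : set 'rV[R]_d) = 0%E.
Proof. by rewrite /gauge; case: asboolP. Qed.

(** The bound holds for empty sets as well, although their diameter is [-oo]. *)
Lemma gauge_le s U (D : R) : 0 <= s -> 0 <= D -> (diam U <= D%:E)%E ->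
  (gauge s U <= (D `^ s)%:E)%E.
Proof.
move=> s0 D0 UD; rewrite /gauge; case: asboolP => [_|/eqP/set0P[x Ux]].
  by rewrite lee_fin powR_ge0.
rewrite -poweR_EFin; apply: gt0_ler_poweR => //.
- by rewrite in_itv/= (diam_ge0 Ux) leey.
- by rewrite in_itv/= lee_fin D0 leey.
Qed.

Lemma premeasure_ge0 s delta A : (0 <= hausdorff_premeasure s delta A)%E.
Proof.
apply: le_ereal_inf_tmp => _ [U _ <-]; apply: nneseries_ge0 => n _ _.
exact: gauge_ge0.
Qed.

Lemma premeasure_le s delta A B : A `<=` B ->
  (hausdorff_premeasure s delta A <= hausdorff_premeasure s delta B)%E.
Proof.
move=> AB; apply: ereal_inf_le_tmp => _ [U [BU Ud] <-]; exists U => //.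
by split => //; exact: subset_trans BU.
Qed.

Lemma hausdorff_measure_eq0 s A :
  hausdorff_measure s A = 0%E <->
  forall delta, 0 < delta -> hausdorff_premeasure s delta A = 0%E.
Proof.
split=> [h delta delta0|h].
  apply/eqP; rewrite eq_le premeasure_ge0 andbT -h.
  by apply: ereal_sup_ubound; exists delta.
apply/eqP; rewrite eq_le; apply/andP; split.
  by apply: ge_ereal_sup => _ [delta /= delta0 <-]; rewrite h.
by apply: ereal_sup_ubound; exists 1 => //=; rewrite h.
Qed.

(** Countable subadditivity for null sets: covers with sums
    [e / 2 ^ (m + 1)] are merged into one. *)
Lemma hausdorff_measure_eq0_bigcup s A (E : nat -> set 'rV[R]_d) :
  A `<=` \bigcup_m E m -> (forall m, hausdorff_measure s (E m) = 0%E) ->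
  hausdorff_measure s A = 0%E.
Proof.
move=> AE E0; apply/hausdorff_measure_eq0 => delta delta0.
apply/eqP; rewrite eq_le premeasure_ge0 andbT.
apply: (le_trans (premeasure_le _ _ AE)).
apply/lee_addgt0Pr => e e0; rewrite add0e.
have hm m : exists U : nat -> set 'rV[R]_d, [/\ E m `<=` \bigcup_n U n,
    forall n, (diam (U n) <= delta%:E)%E &
    (\sum_(0 <= n <oo) gauge s (U n) <= (e / (2 ^ m.+1)%:R)%:E)%E].
  have : (hausdorff_premeasure s delta (E m) < (e / (2 ^ m.+1)%:R)%:E)%E.
    rewrite (proj1 (hausdorff_measure_eq0 s (E m)) (E0 m) delta delta0).
    by rewrite lte_fin divr_gt0// ltr0n expn_gt0.
  by move=> /ereal_inf_lt[_ [U [EU Ud] <-]] /ltW h; exists U.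
have [U hU] := choice hm.
(* the doubly indexed cover is listed along a bijection of the index sets *)
have [f] := ppcard_eqP card_nat2.
have gE : (\sum_(0 <= n <oo) gauge s ((uncurry U \o f^-1%FUN) n) =
    \sum_(0 <= m <oo) \sum_(0 <= n <oo) gauge s (U m n))%E.
  rewrite nneseries_esumT => [|n]; last exact: gauge_ge0.
  rewrite -(@reindex_esum _ _ _ [set: nat] [set: nat * nat] f^-1%FUN
    (fun k => gauge s (uncurry U k)))//.
  have sum_ge0 m : (0 <= \sum_(0 <= n <oo) gauge s (U m n))%E.
    by apply: nneseries_ge0 => n _ _; exact: gauge_ge0.
  rewrite nneseries_esumT//.
  rewrite [RHS](eq_esum (b := fun m => \esum_(n in setT) gauge s (U m n))%E);
    last by move=> m _; rewrite nneseries_esumT// => n; exact: gauge_ge0.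
  rewrite esum_esum => [|m n _ _]; last exact: gauge_ge0.
  rewrite (_ : setT `*`` _ = setT); last by apply/seteqP; split.
  by apply: eq_esum => -[m n].
apply: (@le_trans _ _ (\sum_(0 <= n <oo) gauge s ((uncurry U \o f^-1%FUN) n))%E).
  apply: ereal_inf_lbound; exists (uncurry U \o f^-1%FUN) => //; split.
    move=> x [m _ Emx]; have [/(_ x Emx)[n _ Umn] _ _] := hU m.
    by exists (f (m, n)) => //=; rewrite funK ?inE.
  move=> n /=; move: (X in uncurry U X) => [i j] /=.
  by case: (hU i).
rewrite gE; apply: le_trans (epsilon_trick0 xpredT (ltW e0)).
apply: lee_nneseries => [m _ _|m _].
  by apply: nneseries_ge0 => n _ _; exact: gauge_ge0.
by have [_ _] := hU m.
Qed.

End Hausdorff.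

(** * The multifractal spectrum is at most the coarse spectrum *)

Section Packing.
Variables (R : realType) (d : nat).

(** Adding balls one at a time stops only when the doubled balls cover.  Bounding
    the number of steps by [K] avoids any discussion of total boundedness. *)
Lemma packing_or_cover (E : set 'rV[R]_d) (delta : R) (K : nat) : 0 < delta ->
  exists n (x : 'I_n -> 'rV[R]_d), [/\ forall i, E (x i),
    forall i j, i != j -> eball (x i) delta `&` eball (x j) delta = set0 &
    (K <= n)%N \/ E `<=` \bigcup_i eball (x i) (2 * delta)].
Proof.
move=> delta0.
elim: K => [|K [n [x [Ex dx [Kn|cov]]]]].
- exists 0%N, (fun _ => 0); split; [by case|by case|by left].
- have [cov|] := pselect (E `<=` \bigcup_i eball (x i) (2 * delta)).
    by exists n, x; split => //; right.
  move=> /existsNP[y /not_implyP[Ey ny]].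
  have dy i : eball (x i) delta `&` eball y delta = set0.
    apply/eqP/negPn/negP => /set0P[z [xz yz]]; apply: ny; exists i => //.
    apply: (le_trans (edist_triangle z _ _)); rewrite (edistC z).
    by rewrite /eball/= in xz yz; lra.
  exists n.+1, (fun i => oapp x y (unlift ord0 i)); split.
  + move=> i; case: unliftP => [j|] _ /=; [exact: Ex|exact: Ey].
  + move=> i j; case: (unliftP ord0 i) => [i' ->|->]; case: (unliftP ord0 j) => [j' ->|->] /= ij.
    * by apply: dx; apply: contra ij => /eqP ->.
    * exact: dy.
    * by rewrite setIC; exact: dy.
    * by move: ij; rewrite ?eqxx.
  + by left.
- by exists n, x; split => //; right.
Qed.

Lemma premeasure_cover_le (E : set 'rV[R]_d) (s delta rho : R) n
    (x : 'I_n -> 'rV[R]_d) : 0 <= s -> 0 <= rho -> 2 * rho <= delta ->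
  E `<=` \bigcup_i eball (x i) rho ->
  (hausdorff_premeasure s delta E <= (n%:R * (2 * rho) `^ s)%:E)%E.
Proof.
move=> s0 rho_ge0 rhod cov.
(* empty sets complete the finite cover to a sequence at no cost *)
pose U k := if insub k is Some i then eball (x i) rho else set0.
have dU k : (diam (U k) <= (2 * rho)%:E)%E.
  rewrite /U; case: insubP => [i _ _|_]; first exact: diam_eball.
  by apply: ge_ereal_sup => _ [[a b] [/= []]].
apply: (@le_trans _ _ (\sum_(0 <= k <oo) gauge s (U k))%E).
  apply: ereal_inf_lbound; exists U => //; split.
    by move=> y /cov[i _ xy]; exists i => //; rewrite /U valK.
  by move=> k; apply: (le_trans (dU k)); rewrite lee_fin.
apply: nneseries_le => [k|M]; first exact: gauge_ge0.
apply: (@le_trans _ _ (\sum_(0 <= k < M + n) gauge s (U k))%E).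
  by apply: lee_sum_nneg_natr => [k _ _|]; [exact: gauge_ge0|exact: leq_addr].
rewrite (big_cat_nat (n := n)) ?leq_addl//= [X in (_ + X)%E]big_nat_cond.
rewrite [X in (_ + X)%E]big1.
  rewrite adde0 big_mkord mulr_natl -[X in (_ *+ X)%R]card_ord -sumr_const -sumEFin.
  apply: lee_sum => k _; apply: gauge_le => //; exact: mulr_ge0.
move=> k /andP[/andP[nk _] _]; rewrite /U insubN ?gauge_set0// -leqNgt//.
Qed.

Variables (mu : probability (borelRd R d) R) (alpha : R).

Lemma coarse_quotient_ge (rho delta : R) n (x : 'I_n -> 'rV[R]_d) :
  0 < delta -> delta < 1 -> (0 < n)%N -> coarse_packing mu alpha rho delta x ->
  ((ln n%:R / - ln delta)%:E <=
    lne (coarse_number mu alpha rho delta) * ((- ln delta)^-1)%:E)%E.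
Proof.
move=> delta0 delta1 n0 px.
have l0 : 0 < - ln delta by rewrite oppr_gt0 ln_lt0// delta0.
rewrite EFinM; apply: lee_wpmul2r; first by rewrite lee_fin invr_ge0 ltW.
have nR : (0 : R) < n%:R by rewrite ltr0n.
have nle : ((n%:R : R)%:E <= coarse_number mu alpha rho delta)%E.
  by apply: ereal_sup_ubound; exists n => //; exists x.
rewrite -lne_EFin//; rewrite lee_lne// in_itv/= leey andbT.
  by rewrite lee_fin ltW.
by apply: le_trans nle; rewrite lee_fin ltW.
Qed.

Lemma le_limf_einf0 (f : R -> \bar R) (y : \bar R) (e : R) : 0 < e ->
  (forall x, 0 < x -> x < e -> (y <= f x)%E) -> (y <= limf_einf f 0^'+)%E.
Proof.
move=> e0 h; rewrite limf_einfE.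
apply: (@le_trans _ _ (ereal_inf (f @` [set x | 0 < x < e]))).
  by apply: le_ereal_inf_tmp => _ [x /= /andP[x0 xe] <-]; exact: h.
apply: ereal_sup_ubound; exists [set x | 0 < x < e] => //.
by apply/nbhs0_rightP; exists e => // x x0 xe /=; rewrite x0.
Qed.

(** A set on which the local dimension is uniformly close to [alpha] at all
    small scales: a maximal packing centred in it is seen by the coarse
    spectrum, and the doubled balls cover it. *)
Lemma mf_spectrum_le_coarse (rho : R) : 0 < rho ->
  (mf_spectrum mu alpha <= coarse_spectrum_at mu alpha rho)%E.
Proof.
move=> rho0; rewrite /mf_spectrum; set E := (X in hausdorff_dim X).
apply: lee_lt_real => t; rewrite /hausdorff_dim; case: asboolP => // /eqP/set0P Ene.
move=> tE.
(* on [F m] the control of the balls holds uniformly below the radius [1 / (m + 1)] *)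
pose F m := [set x | supp mu x /\ forall delta, 0 < delta -> delta < m.+1%:R^-1 ->
  `|ln (fine (mu (eball x delta))) / ln delta - alpha| <= rho].
have EF : E `<=` \bigcup_m F m.
  move=> x [sx /cvgrPdist_le/(_ _ rho0)/nbhs0_rightP[e e0 he]].
  exists (Num.truncn e^-1) => //; split => // delta d0 de.
  rewrite distrC; apply: he => //; apply: (lt_le_trans de).
  by rewrite invf_ple ?posrE//; exact/ltW/truncnS_gt.
have packF m n delta (x : 'I_n -> 'rV[R]_d) : 0 < delta -> delta < m.+1%:R^-1 ->
    (forall i, F m (x i)) ->
    (forall i j, i != j -> eball (x i) delta `&` eball (x j) delta = set0) ->
    coarse_packing mu alpha rho delta x.
  move=> d0 dm Fx dx; split => // i; first by case: (Fx i).
  by have [_ /(_ _ d0 dm)] := Fx i; rewrite ler_distl.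
have [t0|t0] := ltP t 0.
  have [x /EF[m _ Fx]] := Ene.
  apply: (@le_limf_einf0 _ _ (m.+1%:R^-1)); first by rewrite invr_gt0.
  move=> delta d0 dm.
  have d1 : delta < 1 by apply: (lt_le_trans dm); rewrite invf_le1// ler1n.
  have px : coarse_packing mu alpha rho delta (fun _ : 'I_1 => x).
    by apply: (packF m) => // i j; rewrite !ord1 eqxx.
  apply: (le_trans _ (coarse_quotient_ge d0 d1 (ltn0Sn 0) px)).
  by rewrite ln1 mul0r lee_fin ltW.
have [m Fm] : exists m, hausdorff_measure t (F m) <> 0%E.
  apply: contrapT => /forallNP h.
  have : hausdorff_measure t E = 0%E.
    by apply: (hausdorff_measure_eq0_bigcup EF) => m; apply: contrapT; exact: h.
  move=> Et; move: tE; rewrite ltNge => /negP; apply.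
  by apply: ereal_inf_lbound; exists t.
have [delta0 d00 pos] : exists2 delta0, 0 < delta0 &
    (0 < hausdorff_premeasure t delta0 (F m))%E.
  apply: contrapT => h; apply: Fm; apply/hausdorff_measure_eq0 => delta d0.
  apply/eqP; rewrite eq_le premeasure_ge0 andbT leNgt; apply/negP => h'.
  by apply: h; exists delta.
have [h h0 hle] : exists2 h : R, 0 < h &
    (h%:E <= hausdorff_premeasure t delta0 (F m))%E.
  case: hausdorff_premeasure pos => [h| |]//= h0.
    by exists h.
  by exists 1; rewrite ?leey.
apply: lee_lt_real => s; rewrite lte_fin => st.
(* at scale [delta] the packing has at least [h * (4 * delta) `^ - t] balls; the
   factor in front is absorbed by the slack [t - s] once [delta] is small *)
pose c := ln h - t * ln 4.
have ts : 0 < t - s by rewrite subr_gt0.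
apply: (@le_limf_einf0 _ _
   (Num.min (Num.min m.+1%:R^-1 (delta0 / 4)) (Num.min 2^-1 (expR (- (`|c| / (t - s))))))).
  by rewrite !lt_min invr_gt0 ltr0n divr_gt0//= expR_gt0 invr_gt0 ltr0n.
move=> delta d0; rewrite !lt_min => /andP[/andP[dm dd0] /andP[d2 dexp]].
have d1 : delta < 1 by lra.
have l0 : 0 < - ln delta by rewrite oppr_gt0 ln_lt0// d0.
have lbig : `|c| <= (t - s) * - ln delta.
  rewrite mulrC -ler_pdivrMr// lerNr -ler_expR lnK// ltW//.
pose K := (Num.truncn (h / (4 * delta) `^ t)).+1.
have dt0 : 0 < (4 * delta) `^ t by rewrite powR_gt0// mulr_gt0.
have [n [x [Fx dx cov]]] := @packing_or_cover (F m) delta K d0.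
have hn : h / (4 * delta) `^ t <= n%:R.
  case: cov => [Kn|cov].
    by apply: (le_trans (ltW (truncnS_gt _))); rewrite ler_nat.
  have d2d : 2 * (2 * delta) <= delta0 by lra.
  have d2_ge0 : 0 <= 2 * delta by lra.
  have := premeasure_cover_le t0 d2_ge0 d2d cov.
  move=> /(le_trans hle); rewrite lee_fin ler_pdivrMr// mulrA.
  by rewrite (_ : 2 * 2 = 4)//; ring.
have n0 : (0 < n)%N.
  by rewrite -(ltr0n R); apply: lt_le_trans hn; rewrite divr_gt0.
apply: (le_trans _ (coarse_quotient_ge d0 d1 n0 (packF _ _ _ _ d0 dm Fx dx))).
rewrite lee_fin ler_pdivlMr//.
have : ln (h / (4 * delta) `^ t) <= ln n%:R.
  by rewrite ler_ln// posrE ?divr_gt0// ltr0n.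
rewrite ln_div ?posrE// ln_powR lnM ?posrE//.
have := ler_norm (- c); rewrite normrN /c in lbig *; nra.
Qed.

End Packing.

(** * The coarse spectrum is at most the abscissa *)

Lemma le_oppr_ln (R : realType) (x y : R) : 0 < x -> x <= expR (- y) -> y <= - ln x.
Proof. by move=> x0; rewrite -{1}(lnK x0) ler_expR lerNr. Qed.

(** A map with fibers of at most [M] elements loses at most the factor [M]. *)
Lemma sum_le_fibers (R : numDomainType) (T : eqType) (I : finType) (g : I -> T)
    (f : T -> R) (M : nat) :
  (forall v, 0 <= f v) -> (forall v, (#|[pred i | g i == v]| <= M)%N) ->
  \sum_i f (g i) <= M%:R * \sum_(v <- undup [seq g i | i <- enum I]) f v.
Proof.
move=> f0 gM; set B := undup _.
have -> : \sum_i f (g i) = \sum_i \sum_(v <- B) (if g i == v then f v else 0).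
  apply: eq_bigr => i _; rewrite -big_mkcond/=.
  rewrite (eq_bigl (pred1 (g i))); last by move=> v; rewrite /= eq_sym.
  rewrite -big_filter filter_pred1_uniq ?undup_uniq ?big_seq1//.
  by rewrite mem_undup; apply: map_f; rewrite mem_enum.
rewrite exchange_big/= mulr_sumr; apply: ler_sum => v _.
rewrite -big_mkcond/= sumr_const -[leLHS]mulr_natl ler_wpM2r// ler_nat.
exact: gM.
Qed.

Section CoarseUpper.
Variables (R : realType) (d : nat) (mu : probability (borelRd R d) R).

Lemma supp_eball_gt0 x (s : R) : supp mu x -> 0 < s -> (0 < mu (eball x s))%E.
Proof.
move=> sx s0; have d1 : 0 < d.+1%:R :> R by [].
have /sx : (interior (eball x s)) x.
  apply/nbhs_ballP; exists (s / d.+1%:R) => /=; first exact: divr_gt0.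
  move=> y; rewrite -ball_normE/= ltr_pdivlMr// => xy.
  apply: (le_trans (edist_le_norm _ _)); apply: (le_trans _ (ltW xy)).
  by rewrite mulrC ler_wpM2l// ler_nat.
move=> /(_ (open_interior _)) /lt_le_trans; apply; apply: le_measure.
- by rewrite inE; apply: sub_sigma_algebra; exact: open_interior.
- by rewrite inE; exact: measurable_eball.
- exact: interior_subset.
Qed.

Lemma mu_eball_fin x (s : R) : mu (eball x s) = (fine (mu (eball x s)))%:E.
Proof. by rewrite fineK// fin_num_measure//; exact: measurable_eball. Qed.

Lemma coarse_number_ge0 (alpha rho delta : R) :
  (0 <= coarse_number mu alpha rho delta)%E.
Proof.
apply: ereal_sup_ubound; exists 0%N => //.
by exists (fun _ => 0); split => [[]|[]|[]].
Qed.

(** The supremum defining the coarse number need not be attained; a strict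
    inequality still produces an actual packing. *)
Lemma coarse_quotient_gt (alpha rho delta s : R) : 0 < delta -> delta < 1 ->
  (s%:E < lne (coarse_number mu alpha rho delta) * ((- ln delta)^-1)%:E)%E ->
  exists n (x : 'I_n -> 'rV[R]_d), coarse_packing mu alpha rho delta x /\
    expR (s * - ln delta) < n%:R.
Proof.
move=> d0 d1 h; have l0 : 0 < - ln delta by rewrite oppr_gt0 ln_lt0// d0.
have N0 := coarse_number_ge0 alpha rho delta.
have : ((expR (s * - ln delta))%:E < coarse_number mu alpha rho delta)%E.
  rewrite ltNge; apply/negP => Ns; move: h; apply/negP; rewrite -leNgt.
  have : (lne (coarse_number mu alpha rho delta) <= (s * - ln delta)%:E)%E.
    rewrite -[leRHS]expeRK lee_lne//; first by rewrite in_itv/= N0 leey.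
    by rewrite in_itv/= lee_fin expR_ge0 leey.
  move=> /(@lee_wpmul2r _ ((- ln delta)^-1)%:E); rewrite lee_fin invr_ge0 ltW//.
  move=> /(_ isT) /le_trans; apply.
  by rewrite -EFinM mulfK// gt_eqF.
move=> /ereal_sup_gt[_ [n [x px] <-]]; rewrite lte_fin => hn.
by exists n, x.
Qed.

End CoarseUpper.

Section PiecesNearBall.
Variables (R : realType) (d N : nat) (S : 'I_N -> 'rV[R]_d -> 'rV[R]_d).
Variables (r p : 'I_N -> R) (mu : probability (borelRd R d) R).
Hypotheses (hd : (0 < d)%N).
Hypotheses (hr : forall i, 0 < r i < 1) (hS : forall i, is_similarity (S i) (r i)).
Hypotheses (hp : forall i, 0 < p i) (hmu : self_similar_measure S p mu).
Variables (O : set 'rV[R]_d) (o : 'rV[R]_d) (c rho0 : R).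
Hypotheses (c0 : 0 < c) (oO : eball o c `<=` O) (SO : forall i, S i @` O `<=` O)
  (dO : forall i j, i != j -> (S i @` O) `&` (S j @` O) = set0).
Hypotheses (rho00 : 0 < rho0) (muD : mu (eball o rho0) = 1%E).
Variables (a b : R).
Hypotheses (a0 : 0 < a) (ab : a <= b) (b1 : b < 1) (rab : forall i, a <= r i <= b).
Notation word := (seq 'I_N).
Implicit Types (v w : word).

Let r0 i : 0 < r i. Proof. by case/andP: (hr i). Qed.

Lemma hits_diam x s v y : hits S o rho0 x s v -> eball o rho0 y ->
  edist x (Sw S v y) <= s + 2 * rho0 * wprod r v.
Proof.
move=> /asboolP[z zo xz] yo.
apply: (le_trans (edist_triangle (Sw S v z) _ _)); rewrite lerD//.
rewrite (Sw_similarity hS) mulrC ler_wpM2r//; first by rewrite ltW// wprod_gt0.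
apply: (le_trans (edist_triangle o _ _)); rewrite edistC.
by rewrite /eball/= in zo yo; lra.
Qed.

(** The half ball has positive mass, so a piece of diameter at most [delta / 2]
    meets it, and this piece lies in the whole ball. *)
Lemma exists_piece_inside x (delta : R) : supp mu x -> 0 < delta ->
  exists v, [/\ v \in cut r (delta / (4 * rho0 + 1)),
    forall y, eball o rho0 y -> edist x (Sw S v y) <= delta &
    wprod p v <= fine (mu (eball x delta))].
Proof.
move=> sx d0; set e := delta / _.
have k0 : 0 < 4 * rho0 + 1 by have := rho00; lra.
have e0 : 0 < e by rewrite divr_gt0.
have d20 : 0 < delta / 2 by rewrite divr_gt0.
have [v ve hv] : exists2 v, v \in cut r e & hits S o rho0 x (delta / 2) v.
  apply: contrapT => nex.
  have := supp_eball_gt0 sx d20; rewrite ltNge => /negP; apply.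
  apply: (le_trans (mu_le_hits hr hS hp hmu muD _ _ e0)).
  rewrite big_seq_cond big1// => v /andP[ve hv].
  by case: nex; exists v.
have inside y : eball o rho0 y -> edist x (Sw S v y) <= delta.
  move=> /(hits_diam hv)/le_trans; apply.
  have := ltW (cut_lt a0 ab b1 rab e0 ve); rewrite /e ler_pdivlMr// => h.
  have := wprod_gt0 v r0; have := rho00; nra.
exists v; split => //.
by rewrite -lee_fin -mu_eball_fin; exact: (mu_ge_piece hr hS hp hmu muD inside).
Qed.

(** Otherwise the boundedly many pieces meeting the ball would together carry less
    than its mass. *)
Lemma exists_heavy_piece : exists M : nat, forall x (delta : R),
  supp mu x -> 0 < delta -> delta <= 1 ->
  exists v, [/\ v \in cut r delta, hits S o rho0 x delta v &
    fine (mu (eball x delta)) <= M.+1%:R * wprod p v].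
Proof.
have [M hM] := bounded_overlap hd hr hS c0 oO SO dO rho00 ltr01.
exists M => x delta sx d0 d1; apply: contrapT => nex.
have mpos : 0 < fine (mu (eball x delta)).
  by rewrite -lte_fin -mu_eball_fin; exact: supp_eball_gt0.
set m := fine _ in nex mpos.
have := mu_le_hits hr hS hp hmu muD x delta d0.
rewrite mu_eball_fin lee_fin -/m; apply/negP; rewrite -ltNge.
apply: (@le_lt_trans _ _ (\sum_(v <- cut r delta | hits S o rho0 x delta v) (m / M.+1%:R))).
  rewrite big_seq_cond [leRHS]big_seq_cond ler_sum// => v /andP[vd hv].
  rewrite ler_pdivlMr// mulrC leNgt; apply/negP => h.
  by apply: nex; exists v; split => //; exact: ltW.
rewrite big_const_seq iter_addr_0 -mulrnAl ltr_pdivrMr//.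
rewrite -[X in X < _]mulr_natr ltr_pM2l// ltr_nat ltnS.
by have := hM delta x d0 d1; rewrite mul1r.
Qed.

End PiecesNearBall.

Section CoarseLeAbscissa.
Variables (R : realType) (d N : nat) (S : 'I_N -> 'rV[R]_d -> 'rV[R]_d).
Variables (r p : 'I_N -> R) (mu : probability (borelRd R d) R).
Hypotheses (hd : (0 < d)%N).
Hypotheses (hr : forall i, 0 < r i < 1) (hS : forall i, is_similarity (S i) (r i)).
Hypotheses (hp : forall i, 0 < p i) (hmu : self_similar_measure S p mu).
Variables (O : set 'rV[R]_d) (o : 'rV[R]_d) (c rho0 : R).
Hypotheses (c0 : 0 < c) (oO : eball o c `<=` O) (SO : forall i, S i @` O `<=` O)
  (dO : forall i j, i != j -> (S i @` O) `&` (S j @` O) = set0).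
Hypotheses (rho00 : 0 < rho0) (muD : mu (eball o rho0) = 1%E).
Notation word := (seq 'I_N).
Implicit Types (v w : word).

Let r0 i : 0 < r i. Proof. by case/andP: (hr i). Qed.

Lemma cut_nlog (a b e : R) v : 0 < a -> a <= b -> b < 1 ->
  (forall i, a <= r i <= b) -> 0 < e -> e <= 1 -> v \in cut r e ->
  - ln e <= nlog r v <= - ln e - ln a.
Proof.
move=> a0 ab b1 rab e0 e1 ve; rewrite /nlog lerN2 -opprD lerN2.
rewrite -lnM ?posrE// !ler_ln ?posrE ?mulr_gt0 ?wprod_gt0//.
by rewrite (ltW (cut_lt a0 ab b1 rab e0 ve)) mulrC (cut_ge a0 ab b1 rab e0 e1 ve).
Qed.

(** One sufficiently small scale [delta] is enough: the packing at that scale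
    provides both families for [mixing_le_abscissa], the pieces inside the balls
    and the heavy pieces meeting them. *)
Lemma coarse_spectrum_le_abscissa (alpha r1 rho : R) : 0 < r1 -> r1 < rho ->
  (coarse_spectrum_at mu alpha r1 <= sigma_ab_zeta_sim r p alpha rho)%E.
Proof.
move=> r10 r1rho; apply: lee_lt_real => t ht.
have [s st [e0 e00 he]] : exists2 s : R, t < s & exists2 e0 : R, 0 < e0 &
    forall delta, 0 < delta -> delta < e0 -> (s%:E <
    lne (coarse_number mu alpha r1 delta) * ((- ln delta)^-1)%:E)%E.
  move: ht; rewrite /coarse_spectrum_at limf_einfE => /ereal_sup_gt[_ [V V0 <-]] ht.
  have [s ts sV] := lt_real_between ht.
  exists s => //; have /nbhs0_rightP[e0 e00 he] := V0; exists e0 => // delta d0 de.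
  apply: (lt_le_trans sV); apply: ereal_inf_lbound; exists delta => //.
  exact: he.
have [a [b [a0 ab b1 rab]]] := ratio_bounds hr.
have [M hM] := exists_heavy_piece hd hr hS hp hmu c0 oO SO dO rho00 muD.
have [M' hM'] := @card_separated R d 1 (1 + rho0) hd ltr01 (addr_gt0 ltr01 rho00).
pose q := (r1 + rho) / 2.
have r1q : 0 < q - r1 by rewrite /q; lra.
have qrho : q < rho by rewrite /q; lra.
have q0 : 0 <= q by rewrite /q; lra.
pose k := 4 * rho0 + 1.
have k1 : 1 < k by rewrite /k; have := rho00; lra.
have k0 : 0 < k by lra.
pose C := ln k - ln a.
have lna : ln a <= 0 by apply: ln_le0; apply: ltW; exact: le_lt_trans b1.
have lnk : 0 <= ln k by apply: ln_ge0; exact: ltW.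
have M0 : 0 <= ln (M.+1%:R : R) by apply: ln_ge0; rewrite ler1n.
have M'0 : 0 <= ln (M'.+1%:R : R) by apply: ln_ge0; rewrite ler1n.
have C0 : 0 <= C by rewrite /C; lra.
(* [C] bounds how far the sizes of the pieces are from [delta] on the logarithmic
   scale.  Below [expR (- B1)] the slack [q - r1] absorbs the resulting error in
   the excess; below [expR (- B2)] the slack [s - t] absorbs the loss in weight. *)
pose B1 := (`|alpha| * C + ln M.+1%:R) / (q - r1).
pose B2 := (`|t| * C + ln M'.+1%:R) / (s - t).
have B10 : 0 <= B1 by apply: divr_ge0; [apply: addr_ge0 => //; exact: mulr_ge0|exact: ltW].
have B20 : 0 <= B2.
  apply: divr_ge0; [by apply: addr_ge0 => //; exact: mulr_ge0|lra].
pose delta := Num.min (e0 / 2) (Num.min 2^-1 (expR (- (B1 + B2)))).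
have d0 : 0 < delta by rewrite /delta !lt_min expR_gt0 invr_gt0 ltr0n divr_gt0.
have de : delta < e0.
  by apply: (@le_lt_trans _ _ (e0 / 2)); [rewrite /delta !ge_min lexx|lra].
have d1 : delta < 1.
  by apply: (@le_lt_trans _ _ 2^-1); [rewrite /delta !ge_min lexx !orbT|lra].
have dB : B1 + B2 <= - ln delta.
  by apply: le_oppr_ln => //; rewrite /delta !ge_min lexx !orbT.
set l := - ln delta in dB.
have l0 : 0 < l by rewrite oppr_gt0 ln_lt0// d0.
have lB1 : `|alpha| * C + ln M.+1%:R <= (q - r1) * l.
  rewrite [leRHS]mulrC -ler_pdivrMr//; apply: le_trans dB; rewrite -/B1; lra.
have lB2 : `|t| * C + ln M'.+1%:R <= (s - t) * l.
  rewrite [leRHS]mulrC -ler_pdivrMr ?subr_gt0//; apply: le_trans dB; rewrite -/B2; lra.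
have [n [x [[sx dx px] hn]]] := coarse_quotient_gt d0 d1 (he _ d0 de).
rewrite -/l in hn.
have kd0 : 0 < delta / k by rewrite divr_gt0.
have kd1 : delta / k <= 1 by rewrite ler_pdivrMr//; lra.
pose m i := fine (mu (eball (x i) delta)).
have m0 i : 0 < m i.
  by rewrite /m -lte_fin -mu_eball_fin; exact: supp_eball_gt0.
have m_bounds i : (alpha - r1) * l <= - ln (m i) <= (alpha + r1) * l.
  have := px i; rewrite -/(m i).
  have -> : ln delta = - l by rewrite /l opprK.
  by rewrite invrN mulrN -mulNr ler_pdivlMr// ler_pdivrMr.
have /choice[wA hA] : forall i, exists v, [/\ v \in cut r (delta / k),
    forall y, eball o rho0 y -> edist (x i) (Sw S v y) <= delta & wprod p v <= m i].
  by move=> i; apply: (exists_piece_inside hr hS hp hmu rho00 muD a0 ab b1 rab).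
have /choice[wB hB] : forall i, exists v, [/\ v \in cut r delta,
    hits S o rho0 (x i) delta v & m i <= M.+1%:R * wprod p v].
  by move=> i; apply: hM => //; exact: ltW.
have wA_inj : injective wA.
  move=> i j ij; apply/eqP/negPn/negP => /dx.
  have oo : eball o rho0 o by apply: eball_center; exact: ltW.
  suff : (eball (x i) delta `&` eball (x j) delta) (Sw S (wA i) o) by move=> + E; rewrite E.
  split; first by case: (hA i) => _ /(_ _ oo).
  by rewrite ij; case: (hA j) => _ /(_ _ oo).
have wB_fib v : (#|[pred i | wB i == v]| <= M'.+1)%N.
  have [|vB] := boolP (v \in cut r delta); last first.
    rewrite eq_card0// => i; rewrite inE; apply/negP => /eqP E.
    by move: vB; rewrite -E; case: (hB i) => ->.
  move=> vB; apply: leqW; rewrite -card_sig.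
  apply: (hM' (Sw S v o) delta _ (fun i : {i | i \in [pred i | wB i == v]} => x (val i))) => //.
    move=> [i /= /eqP E]; have [_ hit _] := hB i; rewrite E in hit.
    have /asboolP[y yo xy] := hit.
    apply: (le_trans (edist_triangle (Sw S v y) _ _)); rewrite mulrDl mul1r lerD//.
    rewrite (Sw_similarity hS) mulrC ler_pM ?edist_ge0//.
    - by rewrite ltW// wprod_gt0.
    - by rewrite edistC.
    - exact: ltW (cut_lt a0 ab b1 rab d0 vB).
  move=> [i iE] [j jE] ij /=; rewrite mul1r leNgt; apply/negP => xij.
  have /dx E : i != j by apply: contra ij => /eqP ij; apply/eqP/val_inj.
  have : (eball (x i) delta `&` eball (x j) delta) (x j).
    by split; [rewrite /eball/= ltW|apply: eball_center; exact: ltW].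
  by rewrite E.
have lnkd : - ln (delta / k) = l + ln k.
  by rewrite ln_div ?posrE// opprB addrC.
have logA i : l <= nlog r (wA i) <= l + C.
  have [vc _ _] := hA i.
  have := cut_nlog a0 ab b1 rab kd0 kd1 vc; rewrite lnkd => /andP[h1 h2].
  by rewrite /C; apply/andP; split; lra.
have logB i : l <= nlog r (wB i) <= l + C.
  have [vc _ _] := hB i.
  have := cut_nlog a0 ab b1 rab d0 (ltW d1) vc; rewrite -/l => /andP[h1 h2].
  by rewrite /C; apply/andP; split; lra.
have powR_low v : l <= nlog r v <= l + C -> expR (- (t * l) - `|t| * C) <= wprod r v `^ t.
  move=> /andP[h1 h2]; rewrite (powR_nlog _ _ r0) ler_expR.
  have e1 : `|t * (nlog r v - l)| <= `|t| * C.
    by rewrite normrM ler_wpM2l// ger0_norm; lra.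
  have := ler_norm (t * (nlog r v - l)); lra.
have excess_diff v : l <= nlog r v <= l + C -> `|alpha * (nlog r v - l)| <= `|alpha| * C.
  move=> /andP[h1 h2].
  by rewrite normrM ler_wpM2l// ger0_norm; lra.
have nE : 1 <= n%:R * (expR (- (t * l) - `|t| * C) / M'.+1%:R).
  apply: (@le_trans _ _ (expR (s * l) * (expR (- (t * l) - `|t| * C) / M'.+1%:R))); last first.
    by rewrite ler_wpM2r ?divr_ge0 ?expR_ge0// ltW.
  rewrite mulrA ler_pdivlMr// mul1r -expRD -[leLHS]lnK ?posrE// ler_expR.
  lra.
apply: (@mixing_le_abscissa _ _ r p alpha q rho t
   [seq wA i | i <- enum 'I_n] (undup [seq wB i | i <- enum 'I_n])) => //.
- by rewrite map_inj_uniq// enum_uniq.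
- exact: undup_uniq.
- move=> v w /mapP[i _ ->] /mapP[j _ ->].
  by apply: (cut_prefix_free a0 ab b1 rab kd0); [case: (hA i)|case: (hA j)].
- move=> v w; rewrite !mem_undup => /mapP[i _ ->] /mapP[j _ ->].
  by apply: (cut_prefix_free a0 ab b1 rab d0); [case: (hB i)|case: (hB j)].
- apply/negP => /mapP[i _ E]; have := logA i; rewrite -E nlog_nil.
  by move=> /andP[h _]; move: l0; rewrite ltNge h.
- rewrite mem_undup; apply/negP => /mapP[i _ E]; have := logB i; rewrite -E nlog_nil.
  by move=> /andP[h _]; move: l0; rewrite ltNge h.
- move=> _ /mapP[i _ ->].
  have [_ _ pm] := hA i; have /andP[mb _] := m_bounds i.
  have : - ln (m i) <= nlog p (wA i).
    by rewrite lerN2 ler_ln ?posrE// wprod_gt0.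
  have := excess_diff _ (logA i); rewrite ler_norml => /andP[h1 h2].
  have /andP[h3 h4] := logA i; rewrite /excess.
  have : (q - r1) * l <= (q - r1) * nlog r (wA i) by rewrite ler_pM2l.
  have : r1 * l <= r1 * nlog r (wA i) by rewrite ler_pM2l.
  lra.
- move=> v; rewrite mem_undup => /mapP[i _ ->].
  have [_ _ pm] := hB i; have /andP[_ mb] := m_bounds i.
  have : nlog p (wB i) <= - ln (m i) + ln M.+1%:R.
    have : ln (m i) <= ln (M.+1%:R * wprod p (wB i)).
      by rewrite ler_ln ?posrE ?mulr_gt0 ?wprod_gt0.
    rewrite lnM ?posrE ?wprod_gt0// /nlog; lra.
  have := excess_diff _ (logB i); rewrite ler_norml => /andP[h1 h2].
  have /andP[h3 h4] := logB i; rewrite /excess.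
  have : (q - r1) * l <= (q - r1) * nlog r (wB i) by rewrite ler_pM2l.
  have : r1 * l <= r1 * nlog r (wB i) by rewrite ler_pM2l.
  lra.
- rewrite big_map big_enum/=; apply: (le_trans nE).
  rewrite mulr_natl -[X in _ *+ X]card_ord -sumr_const ler_sum// => i _.
  apply: (le_trans _ (powR_low _ (logA i))).
  by rewrite ler_pdivrMr// ler_peMr ?expR_ge0// ler1n.
- rewrite -(@ler_pM2l _ M'.+1%:R)// mulr1.
  apply: (le_trans _ (sum_le_fibers (f := fun v => wprod r v `^ t) _ wB_fib)); last first.
    by move=> v; exact: powR_ge0.
  apply: (@le_trans _ _ (n%:R * expR (- (t * l) - `|t| * C))).
    by move: nE; rewrite mulrA ler_pdivlMr// mul1r.
  rewrite mulr_natl -[X in _ *+ X]card_ord -sumr_const ler_sum// => i _.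
  exact: powR_low (logB i).
Qed.

End CoarseLeAbscissa.

(** * Block sequences, branches and interpolation *)

(** Staying at an index until [k] is large compared with [L] makes [L (j k)]
    negligible against [k], however fast [L] grows. *)
Lemma slow_index (L : nat -> nat) : exists j : nat -> nat,
  (forall M, exists k0, forall k, (k0 <= k)%N -> (M <= j k)%N) /\
  (forall M, exists k0, forall k, (k0 <= k)%N -> (M * L (j k) <= k)%N).
Proof.
pose j k := \max_(i < k.+1 | (L i * i <= k)%N) i.
have jbig M k : (maxn M (L M * M) <= k)%N -> (M <= j k)%N.
  rewrite geq_max => /andP[Mk Lk]; rewrite -ltnS in Mk.
  by apply: (@leq_bigmax_cond _ _ (fun i : 'I_k.+1 => i : nat) (Ordinal Mk)).
have jL k : (L (j k) * j k <= k)%N.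
  have [|i iP ji] := @eq_bigmax_cond _ [pred i : 'I_k.+1 | (L i * i <= k)%N] (fun i => i : nat).
    by apply/card_gt0P; exists ord0; rewrite inE muln0.
  by rewrite /j ji.
exists j; split => M; first by exists (maxn M (L M * M)) => k; exact: jbig.
exists (maxn M (L M * M)) => k /jbig Mj.
by apply: leq_trans (jL k); rewrite mulnC leq_mul2l Mj orbT.
Qed.

Section Branch.
Variables (R : realType) (T : eqType) (W : nat -> seq T) (Q : seq T -> R).
Hypotheses (Q0 : forall a, 0 <= Q a) (Q1 : Q [::] = 1) (uW : forall k, uniq (W k)).
Hypothesis Qsum : forall a, Q a <= \sum_(w <- W (size a)) Q (rcons a w).
Variable a : nat -> seq T.

Let Psi v : \bar R := (\sum_(0 <= n <oo) (if prefix v (a n) then Q (a n) else 0)%:E)%E.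

Let term_ge0 v n : (0 <= (if prefix v (a n) then Q (a n) else 0)%:E)%E.
Proof. by rewrite lee_fin; case: ifP. Qed.

Let child_terms v b : \sum_(w <- W (size v)) (if prefix (rcons v w) b then Q b else 0)
  <= if prefix v b then Q b else 0.
Proof.
case: ifPn => vb; last first.
  rewrite big1// => w _; rewrite ifF//; apply: contraNF vb => /prefixP[s ->].
  by rewrite cat_rcons prefix_prefix.
case/prefixP: vb => s bE.
have E w : prefix (rcons v w) b = prefix [:: w] s.
  by rewrite bE -cats1 prefix_catr// eqxx.
under eq_bigr do rewrite E.
case: s {bE E} => [|x s]; first by rewrite big1.
under eq_bigr do rewrite prefix_cons prefix0s andbT.
rewrite -big_mkcond/=; have [xW|xW] := boolP (x \in W (size v)).
  by rewrite -big_filter filter_pred1_uniq ?big_seq1.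
by rewrite big_seq_cond big1// => w /andP[wW /eqP wx]; rewrite -wx wW in xW.
Qed.

Let child v : (Psi v < (Q v)%:E)%E ->
  exists2 w, w \in W (size v) & (Psi (rcons v w) < (Q (rcons v w))%:E)%E.
Proof.
move=> vQ; apply: contrapT => h.
have {}h w : w \in W (size v) -> ((Q (rcons v w))%:E <= Psi (rcons v w))%E.
  by move=> wW; rewrite leNgt; apply/negP => h'; apply: h; exists w.
move: vQ; rewrite ltNge => /negP; apply.
apply: (@le_trans _ _ (\sum_(w <- W (size v)) Psi (rcons v w))%E).
  apply: (@le_trans _ _ (\sum_(w <- W (size v)) (Q (rcons v w))%:E)%E).
    by rewrite sumEFin lee_fin Qsum.
  by rewrite big_seq [leRHS]big_seq; apply: lee_sum => w; exact: h.
rewrite -nneseries_sum//; apply: lee_nneseries => n _.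
  by move=> _; apply: sume_ge0.
by rewrite sumEFin lee_fin child_terms.
Qed.

(** A mass distribution argument without a measure: as long as the total weight
    of countably many cylinders is below [1], one can keep choosing a child in
    which the cylinders still lying inside have less than its weight; the branch
    obtained in this way lies in none of them. *)
Lemma branch_avoiding : (\sum_(0 <= n <oo) (Q (a n))%:E < 1)%E ->
  exists om : nat -> T, (forall k, om k \in W k) /\
    forall n k, mkseq om k <> a n.
Proof.
move=> sum1.
have good0 : (Psi [::] < (Q [::])%:E)%E.
  rewrite Q1; apply: le_lt_trans sum1; rewrite le_eqVlt; apply/orP; left.
  by apply/eqP; apply: eq_eseriesr => n _; rewrite prefix0s.
have [w0 _ _] := child good0.
have /choice[f hf] : forall v, exists w, (Psi v < (Q v)%:E)%E ->
    w \in W (size v) /\ (Psi (rcons v w) < (Q (rcons v w))%:E)%E.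
  move=> v; have [/child[w wW hw]|] := pselect (Psi v < (Q v)%:E)%E.
    by exists w.
  by move=> nv; exists w0.
pose v := fix v k := if k is k'.+1 then rcons (v k') (f (v k')) else [::].
pose om k := f (v k).
have vE k : mkseq om k = v k.
  by elim: k => //= k IH; rewrite mkseqS IH.
have good k : (Psi (v k) < (Q (v k))%:E)%E.
  by elim: k => // k /hf[].
have sv k : size (v k) = k by rewrite -vE size_mkseq.
exists om; split => [k|n k].
  by have [] := hf _ (good k); rewrite sv.
rewrite vE => E; have := good k; rewrite ltNge => /negP; apply.
rewrite /Psi; apply: le_trans (nneseries_lim_ge n.+1 _); last by move=> *; exact: term_ge0.
rewrite big_nat_recr//= E prefix_refl leeDr//.
by apply: sume_ge0 => i _; rewrite lee_fin; case: ifP.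
Qed.

End Branch.

(** Here [ell k] and [pi k] stand for minus the logarithms of the size and the mass
    of the level-[k] piece, and [m l] for that of the mass of a ball of radius
    [expR (- l)].  Since consecutive sizes are comparable on the logarithmic scale,
    knowing the mass at these sizes determines it at all radii up to [eta * l]. *)
Lemma interpolate_rate (R : realType) (ell pi : nat -> R) (m : R -> R)
    (alpha lam c2 c3 : R) :
  0 < lam -> ell 0%N = 0 -> (forall k, lam * k%:R <= ell k) ->
  (forall eta, 0 < eta -> exists C, forall k, ell k.+1 <= (1 + eta) * ell k + C) ->
  (forall eta, 0 < eta ->
     exists C, forall k, `|pi k - alpha * ell k| <= eta * ell k + C) ->
  (forall k l, ell k <= l -> pi k - c2 <= m l) ->
  (forall k l, l <= ell k - c3 -> m l <= pi k) ->
  forall eta, 0 < eta -> exists C, forall l, 0 <= l ->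
    `|m l - alpha * l| <= eta * l + C.
Proof.
move=> lam0 ell0 elam h1 h2 h3 h4 eta eta0.
pose A := `|alpha| + 2.
have A0 : 0 < A by rewrite ltr_wpDl.
(* the errors below add up to at most [A * e * l] plus a constant *)
pose e := Num.min 1 (eta / A).
have e0 : 0 < e by rewrite /e lt_min ltr01 divr_gt0.
have e1 : e <= 1 by rewrite /e ge_min lexx.
have eA : e * A <= eta by rewrite -ler_pdivlMr// /e ge_min lexx orbT.
have [C1 hC1] := h1 e e0; have [C2 hC2] := h2 e e0.
have ell_ge0 k : 0 <= ell k by apply: le_trans (elam k); rewrite mulr_ge0// ltW.
pose D := `|C1| + 2 * `|c3|.
have D0 : 0 <= D by rewrite addr_ge0// mulr_ge0.
have C1D : C1 <= `|C1| by exact: ler_norm.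
have C2D : C2 <= `|C2| by exact: ler_norm.
have far x : exists k, x <= ell k.
  have [k hk] := archimedean_mul x lam0; exists k.
  by apply: le_trans (elam k); exact: hk.
have alx (x B : R) : `|x| <= B -> `|alpha * x| <= `|alpha| * B.
  by move=> h; rewrite normrM ler_wpM2l.
exists (A * D + 2 * `|c3| + `|C2| + `|c2|) => l l0.
have eAl : e * A * l <= eta * l by rewrite ler_wpM2r.
have c2D : c2 <= `|c2| by exact: ler_norm.
have c3D := ler_norm c3; have c3N := ler_norm (- c3); rewrite normrN in c3N.
have c30 : 0 <= `|c3| by []; have c20 : 0 <= `|c2| by []; have C10 : 0 <= `|C1| by [].
have C20 : 0 <= `|C2| by []; have a0 : 0 <= `|alpha| by [].
have el : e * l <= l by rewrite ler_piMl.
have ec : e * `|c3| <= `|c3| by rewrite ler_piMl.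
have eD : e * D <= D by rewrite ler_piMl.
have el0 : 0 <= e * l by rewrite mulr_ge0// ltW.
have aD : 0 <= `|alpha| * D by rewrite mulr_ge0.
rewrite ler_norml; apply/andP; split.
- (* the last level whose scale is still above the given one *)
  have [k kl lk] : exists2 k, ell k <= l & l < ell k.+1.
    have [K hK] := far (l + 1).
    have exK : exists k, l < ell k by exists K; apply: lt_le_trans hK; lra.
    case: (ex_minnP exK) => -[|k] lk min; first by move: lk; rewrite ell0 ltNge l0.
    exists k => //; rewrite leNgt; apply/negP => /min; by rewrite ltnn.
  have := h3 k l kl; have := hC2 k; rewrite ler_norml => /andP[g1 g2].
  have := hC1 k => g3.
  have ek : e * ell k <= e * l by rewrite ler_pM2l.
  have dl : `|l - ell k| <= e * l + D.
    rewrite ger0_norm ?subr_ge0// /D; lra.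
  have := alx _ _ dl; rewrite ler_norml mulrDr mulrBr => /andP[g4 g5].
  rewrite /A in eAl *; nra.
- (* the first level whose scale is below the given one *)
  have [k kl lk] : exists2 k, l + c3 <= ell k & ell k <= (1 + e) * (l + `|c3|) + `|C1|.
    have exK := far (l + c3).
    case: (ex_minnP exK) => -[|k] lk min.
      exists 0%N => //; rewrite ell0 addr_ge0// mulr_ge0//; lra.
    exists k.+1 => //; have h : ell k < l + c3.
      by rewrite ltNge; apply/negP => /min; rewrite ltnn.
    apply: (le_trans (hC1 k)); apply: lerD => //; apply: ler_wpM2l; lra.
  have h4k : l <= ell k - c3 by lra.
  have := h4 k l h4k; have := hC2 k; rewrite ler_norml => /andP[g1 g2].
  have dl : `|ell k - l| <= e * l + D.
    rewrite ler_norml /D; apply/andP; split; lra.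
  have ek : e * ell k <= e * (l + (e * l + D)).
    rewrite ler_pM2l//; move: dl; rewrite ler_norml => /andP[_]; lra.
  have eel : e * (e * l) <= e * l by rewrite ler_piMl.
  have := alx _ _ dl; rewrite ler_norml mulrDr mulrBr => /andP[g4 g5].
  rewrite /A in eAl *; nra.
Qed.

Section Blocks.
Variables (R : realType) (N : nat) (r p : 'I_N -> R) (alpha : R).
Hypotheses (hr : forall i, 0 < r i < 1) (hp : forall i, 0 < p i).
Notation word := (seq 'I_N).
Implicit Types (u v w : word).

Let r0 i : 0 < r i. Proof. by case/andP: (hr i). Qed.

(** The slack between [t] and [t1] pays for the fixed suffix [u] once the words
    are long. *)
Lemma exists_block u (t t1 eta : R) : t < t1 -> 0 < eta ->
  (forall rho, 0 < rho -> (t1%:E < sigma_ab_zeta_sim r p alpha rho)%E) ->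
  exists n (W : seq word), [/\ uniq W, (forall w, w \in W -> size w = n),
    (forall w, w \in W -> w <> [::]),
    (forall w, w \in W -> `|excess r p alpha (w ++ u)| <= eta * nlog r (w ++ u)) &
    1 <= \sum_(w <- W) wprod r (w ++ u) `^ t].
Proof.
move=> tt1 eta0 ht; pose e := (t1 - t) / 2.
have e0 : 0 < e by rewrite /e; lra.
have eta2 : 0 < eta / 2 by lra.
have [c c0 hc] := nlog_ge_size hr.
have [n1 h1] := archimedean_mul (`|t| * nlog r u) (mulr_gt0 e0 c0).
have [n2 h2] := archimedean_mul `|excess r p alpha u| (mulr_gt0 eta2 c0).
have [n nn hn] := abscissa_lt_levels hr (maxn n1 n2) e0 (ht _ eta2).
move: nn; rewrite geq_max => /andP[/h1 {}h1 /h2 {}h2].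
exists n, [seq w <- level N n | `[< zeta_sim_index r p alpha (eta / 2) w >]].
have memW w : w \in [seq w <- level N n | `[< zeta_sim_index r p alpha (eta / 2) w >]] ->
   [/\ size w = n, w <> [::] & `|excess r p alpha w| <= eta / 2 * nlog r w].
  rewrite mem_filter mem_level => /andP[/asboolP h /eqP wn].
  by have [] := (zeta_sim_indexE p alpha hr (eta / 2) w).1 h.
have cn w : size w = n -> c * n%:R <= nlog r w by move=> <-; exact: hc.
split.
- exact: filter_uniq (level_uniq _ _).
- by move=> w /memW[].
- by move=> w /memW[].
- move=> w /memW[wn _ hw]; rewrite (excess_cat _ hr hp) nlog_cat//.
  apply: (le_trans (ler_normD _ _)); have := cn w wn.
  rewrite -(ler_pM2l eta2) mulrA => cw; have := nlog_ge0 hr u.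
  nra.
- apply: (le_trans hn); rewrite -big_filter big_seq [leRHS]big_seq ler_sum// => w.
  move=> /memW[wn _ _]; rewrite wprod_cat powRM ?(ltW (wprod_gt0 _ r0))//.
  rewrite (powR_split hr w t (t1 - e)) -mulrA ler_peMr ?powR_ge0//.
  rewrite (powR_nlog _ _ r0) -expRD -[leLHS]expR0 ler_expR.
  have := cn w wn; rewrite -(ler_pM2l e0) mulrA => cw.
  have -> : t1 - e - t = e by rewrite /e; field.
  have := ler_norm (t * nlog r u); rewrite normrM (ger0_norm (nlog_ge0 hr u)).
  lra.
Qed.

(** The blocks for the tolerances [1 / (k + 1)] are repeated so often that one
    block is negligible against all the previous ones; this keeps the sizes at
    consecutive levels comparable on the logarithmic scale. *)
Lemma exists_block_sequence u (t t1 : R) : t < t1 ->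
  (forall rho, 0 < rho -> (t1%:E < sigma_ab_zeta_sim r p alpha rho)%E) ->
  exists W : nat -> seq word,
  [/\ (forall k, uniq (W k) /\ (forall w, w \in W k -> w <> [::])),
      (forall k v w, v \in W k -> w \in W k -> size v = size w),
      (forall k, 1 <= \sum_(w <- W k) wprod r (w ++ u) `^ t),
      (forall eta, 0 < eta -> exists k0, forall k w, (k0 <= k)%N -> w \in W k ->
        `|excess r p alpha (w ++ u)| <= eta * nlog r (w ++ u)) &
      (forall eta, 0 < eta -> exists C, forall k w, w \in W k ->
        nlog r (w ++ u) <= eta * k%:R + C)].
Proof.
move=> tt1 ht.
have inv0 k : 0 < k.+1%:R^-1 :> R by rewrite invr_gt0.
have /choice[nn /choice[V hV]] : forall k : nat, exists n, exists W : seq word,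
   [/\ uniq W, (forall w, w \in W -> size w = n),
    (forall w, w \in W -> w <> [::]),
    (forall w, w \in W -> `|excess r p alpha (w ++ u)| <= k.+1%:R^-1 * nlog r (w ++ u)) &
    1 <= \sum_(w <- W) wprod r (w ++ u) `^ t].
  by move=> k; exact: exists_block (inv0 k) ht.
have [j [jbig jslow]] := slow_index nn.
exists (fun k => V (j k)); split.
- by move=> k; have [] := hV (j k).
- by move=> k v w; have [_ h _ _ _] := hV (j k) => /h -> /h ->.
- by move=> k; have [] := hV (j k).
- move=> eta eta0; have [k0 hk0] := jbig (Num.truncn eta^-1).
  exists k0 => k w kk0; have [_ _ _ h _] := hV (j k) => /h/le_trans; apply.
  rewrite ler_wpM2r ?nlog_ge0// invf_ple ?posrE//.
  apply: (le_trans (ltW (truncnS_gt _))); rewrite ler_nat ltnS.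
  exact: hk0.
- move=> eta eta0; have [c c0 hc] := nlog_le_size r0.
  have [M hM] := archimedean_mul c eta0.
  have [k0 hk0] := jslow M.
  exists (c * (\sum_(k < k0) nn (j k))%:R + nlog r u) => k w wV.
  have -> : nlog r (w ++ u) = nlog r w + nlog r u by rewrite nlog_cat.
  rewrite addrA lerD2r; apply: (le_trans (hc w)).
  have [_ h _ _ _] := hV (j k); rewrite (h w wV).
  have [kk|kk] := leqP k0 k.
    apply: (@le_trans _ _ (eta * k%:R)); last by rewrite lerDl mulr_ge0// ltW.
    apply: (@le_trans _ _ (eta * M%:R * (nn (j k))%:R)).
      by rewrite ler_wpM2r// hM.
    by rewrite -mulrA ler_pM2l// -natrM ler_nat hk0.
  apply: (@le_trans _ _ (c * (\sum_(k < k0) nn (j k))%:R)).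
    by rewrite ler_pM2l// ler_nat (bigD1 (Ordinal kk))//= leq_addr.
  by rewrite lerDr mulr_ge0// ltW.
Qed.

End Blocks.

(** * The Moran set *)

Section MoranSet.
Variables (R : realType) (d N : nat) (S : 'I_N -> 'rV[R]_d -> 'rV[R]_d).
Variables (r : 'I_N -> R).
Hypotheses (hr : forall i, 0 < r i < 1) (hS : forall i, is_similarity (S i) (r i)).
Variables (o : 'rV[R]_d) (rho0 : R).
Hypotheses (rho00 : 0 < rho0) (SD : forall i, S i @` eball o rho0 `<=` eball o rho0).
Notation word := (seq 'I_N).
Implicit Types (v w : word).

Let r0 i : 0 < r i. Proof. by case/andP: (hr i). Qed.

Lemma Sw_image_ball v x :
  (exists2 y, eball o rho0 y & x = Sw S v y) <-> eball (Sw S v o) (wprod r v * rho0) x.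
Proof.
have v0 : 0 < wprod r v by exact: wprod_gt0.
split=> [[y yo ->]|]; rewrite /eball/=.
  by rewrite (Sw_similarity hS) ler_pM2l.
have [T [_ TK]] := similarity_bij v0 (Sw_similarity hS v).
rewrite -{1}(TK x) (Sw_similarity hS) ler_pM2l// => h.
by exists (T x).
Qed.

(** By compactness, nested pieces have a common point. *)
Lemma nested_pieces (z : nat -> word) : (forall k, exists s, z k.+1 = z k ++ s) ->
  exists x, forall k, exists2 y, eball o rho0 y & x = Sw S (z k) y.
Proof.
move=> hz.
have oD : eball o rho0 o by apply: eball_center; exact: ltW.
have cD : compact (eball o rho0).
  apply: bounded_closed_compact; last exact: closed_eball.
  exists (`|o| + rho0); split => //; first by rewrite num_real.
  move=> M hM y yo /=; apply: ltW; apply: le_lt_trans hM.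
  rewrite -[y](subrK o) addrC; apply: (le_trans (ler_normD _ _)); rewrite lerD2l.
  apply: (le_trans (norm_le_edist _ _)); by rewrite edistC.
pose xs n := Sw S (z n) o.
have Fx : (xs n @[n --> \oo]) (eball o rho0).
  by exists 0%N => // n _; exact: (Sw_sub _ SD).
have [x [xD xcl]] := cD _ _ Fx.
exists x => k; apply/Sw_image_ball; apply: (@closed_eball _ _ _ _ x).
move=> B Bx; apply: xcl => //.
exists k => // n /= kn; have [s zs] := nested_words hz kn.
apply/Sw_image_ball; exists (Sw S s o); first exact: Sw_sub.
by rewrite /xs zs Sw_cat.
Qed.

Variables (u : word) (t : R) (W : nat -> seq word).
Hypothesis isolated : forall j v,
  v \in cut r (wprod r (j ++ u)) -> near S r o rho0 (j ++ u) v -> prefix j v.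
Hypotheses (uW : forall k, uniq (W k) /\ (forall w, w \in W k -> w <> [::]))
  (sizeW : forall k v w, v \in W k -> w \in W k -> size v = size w).

(** The suffix [u] keeps the piece of each block away from the other
    branches. *)
Definition path_word (a : seq word) : word := flatten [seq w ++ u | w <- a].

Lemma path_word_rcons a w : path_word (rcons a w) = path_word a ++ (w ++ u).
Proof. by rewrite /path_word map_rcons flatten_rcons. Qed.

Definition admissible (om : nat -> word) := forall k, om k \in W k.

Definition path_point (om : nat -> word) x := forall k,
  exists2 y, eball o rho0 y & x = Sw S (path_word (mkseq om k)) y.

Lemma exists_admissible : (forall k, 1 <= \sum_(w <- W k) wprod r (w ++ u) `^ t) ->
  exists om, admissible om.
Proof.
move=> sumW; have /choice[om hom] : forall k, exists w, w \in W k.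
  move=> k; have := sumW k; case: (W k) => [|w s _].
    by rewrite big_nil ler10.
  by exists w; rewrite mem_head.
by exists om.
Qed.

Lemma exists_path_point om : exists x, path_point om x.
Proof.
apply: (nested_pieces (z := fun k => path_word (mkseq om k))) => k.
by exists (om k ++ u); rewrite mkseqS path_word_rcons.
Qed.

Lemma path_word_size om k : admissible om ->
  (k <= size (path_word (mkseq om k)))%N.
Proof.
move=> ad; elim: k => // k IH.
rewrite mkseqS path_word_rcons !size_cat -addn1 leq_add//.
by have [_ /(_ _ (ad k))] := uW k; case: (om k).
Qed.

Lemma path_word_small om (e : R) : admissible om -> 0 < e ->
  exists k, wprod r (path_word (mkseq om k)) < e.
Proof.
have [a [b [a0 ab b1 rab]]] := ratio_bounds hr.
have b0 : 0 < b by exact: lt_le_trans ab.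
move=> ad e0; have [n hn] := exists_fuel a0 ab b1 e0.
exists n; apply: le_lt_trans hn.
apply: (@le_trans _ _ (b ^+ size (path_word (mkseq om n)))).
  by apply: wprod_le_exp => i; case/andP: (rab i) => _ ->; rewrite ltW.
by apply: ler_wiXn2l; rewrite ?(ltW b0) ?(ltW b1)//; exact: path_word_size.
Qed.

(** At the first level where the paths differ, the piece of [om] ends in [u], so it
    stays away from every word that does not pass through the same block. *)
Lemma path_separation om om' k x x' : admissible om -> admissible om' ->
  path_point om x -> path_point om' x' -> mkseq om k <> mkseq om' k ->
  wprod r (path_word (mkseq om k)) < edist x x'.
Proof.
move=> ad ad' px px' ne.
have [a [b [a0 ab b1 rab]]] := ratio_bounds hr.
(* the first level at which the two paths differ *)
have [l lk [el dl]] : exists2 l, (l < k)%N & mkseq om l = mkseq om' l /\ om l <> om' l.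
  elim: k ne => // k IH ne; have [E|ne'] := pselect (mkseq om k = mkseq om' k).
    exists k => //; split => // h; apply: ne.
    by rewrite !mkseqS E h.
  by have [l lk h] := IH ne'; exists l => //; exact: ltnW.
pose j := path_word (mkseq om l) ++ om l.
pose j' := path_word (mkseq om l) ++ om' l.
have jE : path_word (mkseq om l.+1) = j ++ u by rewrite mkseqS path_word_rcons catA.
have j'E : path_word (mkseq om' l.+1) = j' ++ u.
  by rewrite mkseqS path_word_rcons -el catA.
have sj : size j = size j'.
  by rewrite !size_cat (sizeW (ad l) (ad' l)).
have grow om1 m n : (m <= n)%N ->
    exists s, path_word (mkseq om1 n) = path_word (mkseq om1 m) ++ s.
  apply: (nested_words (z := fun k => path_word (mkseq om1 k))) => i.
  by exists (om1 i ++ u); rewrite mkseqS path_word_rcons.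
have ju0 : 0 < wprod r (j ++ u) by exact: wprod_gt0.
apply: (@le_lt_trans _ _ (wprod r (j ++ u))).
  have [s E] := grow om _ _ lk; rewrite E jE wprod_cat.
  by rewrite ler_piMr ?(ltW ju0)//; exact: wprod_le1.
rewrite ltNge; apply/negP => xx'.
have [m1 hm1] := path_word_small ad' ju0.
pose m := maxn m1 l.+1.
have [s1 E1] := grow om' m1 m (leq_maxl _ _).
have [s2 E2] := grow om' l.+1 m (leq_maxr _ _).
have : wprod r (path_word (mkseq om' m)) < wprod r (j ++ u).
  apply: le_lt_trans hm1; rewrite E1 wprod_cat ler_piMr ?wprod_le1//.
  exact/ltW/wprod_gt0.
move=> /(cut_cover a0 ab b1 rab ju0)[v vc vm].
have nv : near S r o rho0 (j ++ u) v.
  have [y yo xy] := px l.+1; rewrite jE in xy.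
  have [y' yo' xy'] := px' m; case/prefixP: vm => s Es; rewrite Es Sw_cat in xy'.
  apply/asboolP; exists y, (Sw S s y'); split => //; first exact: (Sw_sub _ SD).
  by rewrite -xy -xy'.
have jv := isolated vc nv.
have jm : prefix j (path_word (mkseq om' m)) by exact: prefix_trans vm.
have j'm : prefix j' (path_word (mkseq om' m)).
  by rewrite E2 j'E -catA prefix_prefix.
have := prefix_same_size jm j'm sj; rewrite /j /j' => /eqP.
by rewrite eqseq_cat// eqxx /= => /eqP.
Qed.

End MoranSet.

Section MoranDimension.
Variables (R : realType) (d N : nat) (S : 'I_N -> 'rV[R]_d -> 'rV[R]_d).
Variables (r p : 'I_N -> R) (mu : probability (borelRd R d) R).
Hypotheses (hr : forall i, 0 < r i < 1) (hS : forall i, is_similarity (S i) (r i)).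
Hypotheses (hp : forall i, 0 < p i) (hp1 : \sum_(i < N) p i = 1)
  (hmu : self_similar_measure S p mu).
Variables (o : 'rV[R]_d) (rho0 : R).
Hypotheses (rho00 : 0 < rho0) (SD : forall i, S i @` eball o rho0 `<=` eball o rho0)
  (muD : mu (eball o rho0) = 1%E).
Notation word := (seq 'I_N).
Implicit Types (v w : word).
Variables (u : word) (alpha t : R) (W : nat -> seq word).
Hypothesis isolated : forall j v,
  v \in cut r (wprod r (j ++ u)) -> near S r o rho0 (j ++ u) v -> prefix j v.
Hypotheses (uW : forall k, uniq (W k) /\ (forall w, w \in W k -> w <> [::]))
  (sizeW : forall k v w, v \in W k -> w \in W k -> size v = size w)
  (sumW : forall k, 1 <= \sum_(w <- W k) wprod r (w ++ u) `^ t)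
  (approxW : forall eta, 0 < eta -> exists k0, forall k w, (k0 <= k)%N -> w \in W k ->
    `|excess r p alpha (w ++ u)| <= eta * nlog r (w ++ u))
  (slowW : forall eta, 0 < eta -> exists C, forall k w, w \in W k ->
        nlog r (w ++ u) <= eta * k%:R + C).

Let r0 i : 0 < r i. Proof. by case/andP: (hr i). Qed.
Let ell om k := nlog r (path_word u (mkseq om k)).
Let pi_ om k := nlog p (path_word u (mkseq om k)).

Lemma nlogS (q : 'I_N -> R) om k : (forall i, 0 < q i) ->
  nlog q (path_word u (mkseq om k.+1)) =
  nlog q (path_word u (mkseq om k)) + nlog q (om k ++ u).
Proof. by move=> q0; rewrite mkseqS path_word_rcons nlog_cat. Qed.

Lemma path_ell_ge : exists2 lam : R, 0 < lam &
  forall om k, admissible W om -> lam * k%:R <= ell om k.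
Proof.
have [c c0 hc] := nlog_ge_size hr; exists c => // om k ad.
apply: (le_trans _ (hc _)); rewrite ler_pM2l// ler_nat.
exact: (path_word_size u uW).
Qed.

Lemma path_ellS (eta : R) : 0 < eta -> exists C, forall om k, admissible W om ->
  ell om k.+1 <= (1 + eta) * ell om k + C.
Proof.
move=> eta0; have [lam lam0 hlam] := path_ell_ge.
have [C hC] := slowW (mulr_gt0 eta0 lam0).
exists C => om k ad; rewrite /ell nlogS// mulrDl mul1r -addrA lerD2l.
apply: (le_trans (hC k _ (ad k))); rewrite lerD2r -mulrA ler_pM2l//.
exact: hlam.
Qed.

(** Blocks up to [k0], whose tolerance exceeds [eta], only contribute a
    constant. *)
Lemma path_pi (om : nat -> word) (eta : R) : admissible W om -> 0 < eta ->
  exists C, forall k, `|pi_ om k - alpha * ell om k| <= eta * ell om k + C.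
Proof.
move=> ad eta0; have [k0 hk0] := approxW eta0.
pose C := \sum_(k < k0.+1) `|pi_ om k - alpha * ell om k|.
have small k : (k <= k0)%N -> `|pi_ om k - alpha * ell om k| <= C.
  rewrite -ltnS => kk; rewrite /C (bigD1 (Ordinal kk))//= lerDl.
  by apply: sumr_ge0.
exists C => k; have [kk|/ltnW] := leqP k k0.
  by apply: (le_trans (small k kk)); rewrite lerDr mulr_ge0 ?(ltW eta0) ?nlog_ge0.
elim: k => [|k IH]; first by rewrite leqn0 => /eqP k00; apply: (le_trans (small _ _));
  rewrite ?k00// lerDr mulr_ge0 ?(ltW eta0) ?nlog_ge0.
rewrite leq_eqVlt => /predU1P[<-|].
  by apply: (le_trans (small _ _)) => //; rewrite lerDr mulr_ge0 ?(ltW eta0) ?nlog_ge0.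
rewrite ltnS => kk; have := IH kk; have := hk0 k _ kk (ad k).
rewrite /pi_ /ell !nlogS// /excess => h1 h2.
rewrite (_ : _ - _ = (nlog p (path_word u (mkseq om k)) -
    alpha * nlog r (path_word u (mkseq om k))) +
   (nlog p (om k ++ u) - alpha * nlog r (om k ++ u))); last by ring.
apply: (le_trans (ler_normD _ _)); lra.
Qed.

Lemma ln_mu_le x (s : R) v : (mu (eball x s) <= (wprod p v)%:E)%E ->
  (0 < mu (eball x s))%E -> nlog p v <= - ln (fine (mu (eball x s))).
Proof.
rewrite mu_eball_fin lee_fin lte_fin => h h0.
by rewrite /nlog lerN2 ler_ln// posrE wprod_gt0.
Qed.

(** The level-[k] piece lies in a ball of comparable radius about the point, and
    isolation by [u] bounds the mass of such a ball from above;
    [interpolate_rate] takes care of the radii in between. *)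
Lemma path_point_local_dim om x : admissible W om -> path_point S o rho0 u om x ->
  supp mu x /\ (ln (fine (mu (eball x s))) / ln s @[s --> 0^'+] --> alpha).
Proof.
move=> ad px.
have big k : ((wprod p (path_word u (mkseq om k)))%:E <=
    mu (eball x (2 * rho0 * wprod r (path_word u (mkseq om k)))))%E.
  apply: (mu_ge_piece hr hS hp hmu muD) => y yo.
  have [z zo ->] := px k; rewrite (Sw_similarity hS) mulrC ler_wpM2r//.
    by rewrite ltW// wprod_gt0.
  apply: (le_trans (edist_triangle o _ _)); rewrite edistC.
  by rewrite /eball/= in yo zo; lra.
have mono s s' : s <= s' -> (mu (eball x s) <= mu (eball x s'))%E.
  move=> ss'; apply: le_measure; rewrite ?inE; try exact: measurable_eball.
  by move=> y /=; rewrite /eball/= => /le_trans; apply.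
have pos s : 0 < s -> (0 < mu (eball x s))%E.
  move=> s0; have s20 : 0 < s / (2 * rho0) by rewrite divr_gt0// mulr_gt0.
  have [k hk] := path_word_small hr u uW ad s20.
  apply: (@lt_le_trans _ _ (wprod p (path_word u (mkseq om k)))%:E).
    by rewrite lte_fin wprod_gt0.
  apply: (le_trans (big k)); apply: mono; rewrite mulrC -ler_pdivlMr ?mulr_gt0//.
  exact: ltW.
split.
  move=> U oU Ux; have [c c0 cU] := open_eball_sub oU Ux.
  apply: (lt_le_trans (pos c c0)); apply: le_measure => //; rewrite inE.
    exact: measurable_eball.
  exact: sub_sigma_algebra.
pose m l := - ln (fine (mu (eball x (expR (- l))))).
have fpos l : 0 < fine (mu (eball x (expR (- l)))).
  by rewrite -lte_fin -mu_eball_fin pos// expR_gt0.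
have h3 k l : ell om k <= l -> pi_ om k - nlog p u <= m l.
  case: k => [|k] kl.
    have h1 : 0 <= nlog p u.
      rewrite oppr_ge0 ln_le0//; apply: (@le_trans _ _ (1 ^+ size u)).
        apply: wprod_le_exp => i; rewrite (ltW (hp i))/= -hp1 (bigD1 i)//= lerDl.
        by apply: sumr_ge0 => k _; exact: ltW.
      by rewrite expr1n.
    have h2 : 0 <= m l.
      rewrite oppr_ge0 ln_le0// -lee_fin -mu_eball_fin.
      by apply: probability_le1; exact: measurable_eball.
    rewrite /pi_ /= nlog_nil; lra.
  pose j := path_word u (mkseq om k) ++ om k.
  have jE : path_word u (mkseq om k.+1) = j ++ u by rewrite mkseqS path_word_rcons catA.
  have -> : pi_ om k.+1 - nlog p u = nlog p j by rewrite /pi_ jE nlog_cat// addrK.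
  apply: ln_mu_le; last by rewrite pos// expR_gt0.
  have [y yo xy] := px k.+1; rewrite jE in xy.
  apply: (le_trans _ (mu_isolated_ball hr hS hp hp1 hmu muD j isolated yo)).
  rewrite -xy; apply: mono; rewrite -jE (wprod_nlog _ r0) ler_expR lerN2.
  exact: kl.
have h4 k l : l <= ell om k - ln (2 * rho0) -> m l <= pi_ om k.
  move=> kl; rewrite /m /pi_ /nlog lerN2 ler_ln ?posrE ?wprod_gt0//.
  rewrite -lee_fin -mu_eball_fin; apply: (le_trans (big k)); apply: mono.
  rewrite -[X in X * _]lnK ?posrE ?mulr_gt0// (wprod_nlog _ r0) -expRD ler_expR.
  by rewrite -/(ell om k); lra.
have [lam lam0 hlam] := path_ell_ge.
have rate := interpolate_rate lam0 (_ : ell om 0%N = 0) (fun k => hlam om k ad)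
  (fun eta eta0 => let: ex_intro C hC := path_ellS eta0 in
     ex_intro _ C (fun k => hC om k ad)) (fun eta => path_pi ad) h3 h4.
have {}rate := rate (nlog_nil r).
apply/cvgrPdist_le => e e0.
have e20 : 0 < e / 2 by lra.
have [C hC] := rate _ e20.
apply/nbhs0_rightP.
exists (Num.min 2^-1 (expR (- (`|C| / (e / 2))))).
  by rewrite lt_min invr_gt0 ltr0n expR_gt0.
move=> s s0; rewrite lt_min => /andP[s2 sC].
have s1 : s < 1 by lra.
pose l := - ln s.
have sl : s = expR (- l) by rewrite /l opprK lnK.
have l0 : 0 < l by rewrite oppr_gt0 ln_lt0// s0.
have lC : `|C| <= e / 2 * l.
  rewrite mulrC -ler_pdivrMr//; move: sC; rewrite {1}sl ltr_expR ltrN2.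
  exact: ltW.
have -> : ln (fine (mu (eball x s))) / ln s = m l / l.
  by rewrite /m -sl /l invrN mulrNN.
have := hC l (ltW l0).
have -> : m l - alpha * l = (m l / l - alpha) * l by field; rewrite gt_eqF.
rewrite normrM (gtr0_norm l0) distrC => h.
rewrite -(ler_pM2r l0); apply: (le_trans h); have := ler_norm C; lra.
Qed.

(** The level is chosen so that the diameter of [U] lies between the sizes of the
    pieces at two consecutive levels.  Separation then puts all of [U] into one
    cylinder, and the gap between [t'] and [t] pays for the ratio of the sizes. *)
Lemma path_cylinder_gauge (t' : R) : 0 <= t' -> t' < t -> exists2 C : R, 0 < C &
  forall (U : set 'rV[R]_d) (kappa : R), (diam U <= 1)%E -> 0 < kappa ->
  exists a : seq word,
    (forall om x, admissible W om -> path_point S o rho0 u om x -> U x ->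
       mkseq om (size a) = a) /\
    ((wprod r (path_word u a) `^ t)%:E <= C%:E * gauge t' U + kappa%:E)%E.
Proof.
move=> t'0 t't.
have t0 : 0 < t by exact: le_lt_trans t't.
(* chosen so that [t' * (1 + eta) <= t] *)
pose eta := (t - t') / (t' + 1).
have t'1 : 0 < t' + 1 by lra.
have eta0 : 0 < eta by rewrite divr_gt0// subr_gt0.
have etaE : eta * (t' + 1) = t - t' by rewrite /eta divfK// gt_eqF.
have [C hC] := path_ellS eta0.
have R0 a : 0 < wprod r a by exact: wprod_gt0.
have wC om k : admissible W om -> wprod r (path_word u (mkseq om k)) `^ t <=
    expR (t' * C) * wprod r (path_word u (mkseq om k.+1)) `^ t'.
  move=> ad; rewrite !(powR_nlog _ _ r0) -expRD ler_expR.
  have h1 := ler_wpM2l t'0 (hC om k ad); have h2 := nlog_ge0 hr (path_word u (mkseq om k)).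
  rewrite -/(ell om k) -/(ell om k.+1) in h2 *.
  have : t' * eta * ell om k <= (t - t') * ell om k by rewrite ler_wpM2r// -etaE; nra.
  lra.
exists (expR (t' * C)); first exact: expR_gt0.
move=> U kappa dU kappa0.
have deep om : admissible W om -> exists k,
    wprod r (path_word u (mkseq om k)) `^ t <= kappa.
  move=> ad; have k0 : 0 < kappa `^ t^-1 by exact: powR_gt0.
  have [k hk] := path_word_small hr u uW ad k0; exists k.
  rewrite -[leRHS]powRr1 ?(ltW kappa0)// -(mulVf (lt0r_neq0 t0)) powRrM.
  by apply: ge0_ler_powR; rewrite ?nnegrE ?powR_ge0 ?(ltW t0) ?(ltW (R0 _)) ?(ltW hk).
have gp : (0 <= (expR (t' * C))%:E * gauge t' U)%E.
  by rewrite mule_ge0 ?gauge_ge0// lee_fin expR_ge0.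
have [[om [x [ad px Ux]]]|none] := pselect (exists om, exists x,
    [/\ admissible W om, path_point S o rho0 u om x & U x]); last first.
  have [om ad] := exists_admissible sumW.
  have [k hk] := deep om ad; exists (mkseq om k); split.
    by move=> om' x' ad' px' Ux'; case: none; exists om', x'.
  by rewrite -[leLHS]add0e leeD// lee_fin.
have dU0 := diam_ge0 Ux.
have dfin : diam U = (fine (diam U))%:E.
  by rewrite fineK// ge0_fin_numE// (le_lt_trans dU)// ltry.
set D := fine (diam U) in dfin.
have D0 : 0 <= D by rewrite -lee_fin -dfin.
have D1 : D <= 1 by rewrite -lee_fin -dfin.
have gE : gauge t' U = (D `^ t')%:E.
  rewrite /gauge; case: asboolP => [U0|_]; first by rewrite U0 in Ux.
  by rewrite dfin poweR_EFin.
have cyl k : D <= wprod r (path_word u (mkseq om k)) ->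
    forall om' x', admissible W om' -> path_point S o rho0 u om' x' -> U x' ->
    mkseq om' k = mkseq om k.
  move=> Dk om' x' ad' px' Ux'; apply: contrapT => ne.
  have ne' : mkseq om k <> mkseq om' k by move=> E; apply: ne.
  have := path_separation hr SD isolated uW sizeW ad ad' px px' ne'.
  apply/negP; rewrite -leNgt; apply: le_trans Dk.
  by rewrite -lee_fin -dfin; exact: edist_le_diam.
(* a set of diameter [0] has no natural level: any deep cylinder will do *)
have [D00|Dne] := eqVneq D 0.
  have [k hk] := deep om ad; exists (mkseq om k); split.
    rewrite size_mkseq; apply: cyl; rewrite D00; exact: ltW (R0 _).
  by rewrite -[leLHS]add0e leeD// lee_fin.
have Dgt : 0 < D by rewrite lt_neqAle eq_sym Dne.
have exk : exists k, wprod r (path_word u (mkseq om k)) < D.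
  exact: path_word_small.
case: (ex_minnP exk) => -[|k] Dk min.
  by move: Dk; rewrite /= wprod_nil ltNge D1.
have kD : D <= wprod r (path_word u (mkseq om k)).
  by rewrite leNgt; apply/negP => /min; rewrite ltnn.
exists (mkseq om k); split; first by rewrite size_mkseq; exact: cyl.
rewrite gE -EFinM -EFinD lee_fin; apply: (le_trans (wC om k ad)).
apply: (@le_trans _ _ (expR (t' * C) * D `^ t')); last by rewrite lerDl ltW.
rewrite ler_pM2l ?expR_gt0//.
by apply: ge0_ler_powR; rewrite ?nnegrE ?(ltW (R0 _)) ?(ltW Dk).
Qed.

(** If the sum of a cover were small, the cylinders containing its members would
    have total weight below [1], and some path would avoid them all. *)
Lemma path_points_hausdorff_pos (E : set 'rV[R]_d) (t' : R) : 0 <= t' -> t' < t ->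
  (forall om x, admissible W om -> path_point S o rho0 u om x -> E x) ->
  hausdorff_measure t' E <> 0%E.
Proof.
move=> t'0 t't pE /hausdorff_measure_eq0/(_ 1 ltr01) E0.
have [C C0 hC] := path_cylinder_gauge t'0 t't.
have lt0 : (hausdorff_premeasure t' 1 E < ((2 * C)^-1)%:E)%E.
  by rewrite E0 lte_fin invr_gt0 mulr_gt0.
have [_ [U [EU dU] <-] sumU] := ereal_inf_lt lt0.
have k0 n : 0 < 2^-1 / (2 ^ n.+1)%:R :> R by rewrite divr_gt0// ltr0n expn_gt0.
have /choice[a ha] := fun n => hC (U n) _ (dU n) (k0 n).
have [] := @branch_avoiding R _ W (fun a => wprod r (path_word u a) `^ t) _ _ _ _ a.
- by move=> v; exact: powR_ge0.
- by rewrite wprod_nil powR1.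
- by move=> k; case: (uW k).
- move=> v; under eq_bigr do rewrite path_word_rcons wprod_cat powRM ?(ltW (wprod_gt0 _ r0))//.
  by rewrite -mulr_sumr ler_peMr ?powR_ge0.
- apply: (@le_lt_trans _ _ (\sum_(0 <= n <oo)
     (C%:E * gauge t' (U n) + (2^-1 / (2 ^ n.+1)%:R)%:E))%E).
    apply: lee_nneseries => [n _ _|n _]; first by rewrite lee_fin powR_ge0.
    by case: (ha n).
  have Cg n : (0 <= C%:E * gauge t' (U n))%E.
    by rewrite mule_ge0 ?gauge_ge0// lee_fin ltW.
  have half : (0 : R) <= 2^-1 by rewrite invr_ge0.
  apply: (le_lt_trans (epsilon_trick xpredT Cg half)).
  rewrite nneseriesZl; last by move=> n _; exact: gauge_ge0.
  have : (C%:E * \sum_(0 <= n <oo) gauge t' (U n) < (2^-1)%:E)%E.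
    rewrite (_ : 2^-1 = C * (2 * C)^-1); last by field; rewrite gt_eqF.
    by rewrite EFinM lte_pmul2l// lte_fin.
  set s := (_ * _)%E => hs.
  rewrite (_ : 1%E = (2^-1)%:E + (2^-1)%:E)%E; last by rewrite -EFinD; congr EFin; field.
  by rewrite lteD2rE.
- move=> om [ad av].
  have [x px] := exists_path_point hr hS rho00 SD u om.
  have [n _ Ux] := EU x (pE om x ad px).
  have [h _] := ha n; exact: av n (size (a n)) (h om x ad px Ux).
Qed.

End MoranDimension.

(** * Monotone limits and the conclusion *)

Section Limits.
Variable R : realType.

Lemma nondecreasing_cvg_inf (f : R -> \bar R) :
  (forall x y, 0 < x -> x <= y -> (f x <= f y)%E) ->
  f x @[x --> 0^'+] --> ereal_inf [set f x | x in [set x | 0 < x]].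
Proof.
move=> fh.
have -> : [set f x | x in [set x | 0 < x]] = f @` [set` `]0, +oo[].
  congr (f @` _); apply/seteqP; split => x /=; rewrite in_itv/= andbT//.
apply: nondecreasing_at_right_cvge => // x y.
by rewrite !in_itv/= !andbT => x0 _; exact: fh.
Qed.

Lemma sigma_ab_nondecreasing (N : nat) (r p : 'I_N -> R) (alpha rho rho' : R) :
  rho <= rho' ->
  (sigma_ab_zeta_sim r p alpha rho <= sigma_ab_zeta_sim r p alpha rho')%E.
Proof.
move=> hr; apply: ereal_inf_le_tmp => _ [t st <-]; exists t => //=.
apply: le_lt_trans st; apply: ge_ereal_sup => _ [F [fF FW] <-].
apply: ereal_sup_ubound; exists F => //; split => // w /FW[w0 h].
by split => //; exact: le_trans hr.
Qed.

Lemma coarse_spectrum_at_nondecreasing d (mu : probability (borelRd R d) R)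
    (alpha rho rho' : R) : rho <= rho' ->
  (coarse_spectrum_at mu alpha rho <= coarse_spectrum_at mu alpha rho')%E.
Proof.
move=> hr; rewrite /coarse_spectrum_at !limf_einfE.
have NN delta : (coarse_number mu alpha rho delta <= coarse_number mu alpha rho' delta)%E.
  apply: ge_ereal_sup => _ [n [x [sx dx px]] <-]; apply: ereal_sup_ubound.
  exists n => //; exists x; split => // i; have /andP[h1 h2] := px i.
  by apply/andP; split; lra.
apply: ge_ereal_sup => _ [V V0 <-].
pose V1 := V `&` [set delta : R | 0 < delta < 1].
have V10 : 0^'+ V1.
  have /nbhs0_rightP[e e0 he] := V0; apply/nbhs0_rightP.
  exists (Num.min e 1) => [|x x0]; first by rewrite lt_min e0 ltr01.
  by rewrite lt_min => /andP[xe x1]; split; [exact: he|rewrite /= x0].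
apply: (@le_trans _ _ (ereal_inf [set (lne (coarse_number mu alpha rho' delta) *
   ((- ln delta)^-1)%:E)%E | delta in V1])); last first.
  by apply: ereal_sup_ubound; exists V1.
apply: le_ereal_inf_tmp => _ [delta [Vd /andP[d0 d1]] <-].
apply: (@le_trans _ _ (lne (coarse_number mu alpha rho delta) *
   ((- ln delta)^-1)%:E)%E).
  by apply: ereal_inf_lbound; exists delta.
apply: lee_wpmul2r.
  by rewrite lee_fin invr_ge0 oppr_ge0 ln_le0// ltW.
by rewrite lee_lne// in_itv/= leey coarse_number_ge0.
Qed.

End Limits.

Section AbscissaLeSpectrum.
Variables (R : realType) (d N : nat) (S : 'I_N -> 'rV[R]_d -> 'rV[R]_d).
Variables (r p : 'I_N -> R) (mu : probability (borelRd R d) R).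
Hypotheses (hd : (0 < d)%N).
Hypotheses (hr : forall i, 0 < r i < 1) (hS : forall i, is_similarity (S i) (r i)).
Hypotheses (hp : forall i, 0 < p i) (hp1 : \sum_(i < N) p i = 1)
  (hmu : self_similar_measure S p mu).
Variables (O : set 'rV[R]_d) (o : 'rV[R]_d) (c rho0 : R).
Hypotheses (c0 : 0 < c) (oO : eball o c `<=` O) (SO : forall i, S i @` O `<=` O)
  (dO : forall i j, i != j -> (S i @` O) `&` (S j @` O) = set0).
Hypotheses (rho00 : 0 < rho0) (SD : forall i, S i @` eball o rho0 `<=` eball o rho0)
  (muD : mu (eball o rho0) = 1%E).

(** Every point of the Moran set has local dimension [alpha], and the Moran set
    is not null in any dimension below [t]. *)
Lemma abscissa_le_mf_spectrum (alpha t t1 : R) : t < t1 ->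
  (forall rho, 0 < rho -> (t1%:E < sigma_ab_zeta_sim r p alpha rho)%E) ->
  (t%:E <= mf_spectrum mu alpha)%E.
Proof.
move=> tt1 ht.
have [u isolated] := exists_isolated_word hd hr hS c0 oO SO dO rho00.
have [W [uW sizeW sumW approxW slowW]] := exists_block_sequence hr hp u tt1 ht.
have local := path_point_local_dim hr hS hp hp1 hmu rho00 muD isolated uW approxW slowW.
rewrite /mf_spectrum; set E := (X in hausdorff_dim X).
have pE om x : admissible W om -> path_point S o rho0 u om x -> E x.
  by move=> ad px; exact: local ad px.
have Ene : E <> set0.
  have [om ad] := exists_admissible sumW.
  have [x px] := exists_path_point hr hS rho00 SD u om.
  by move=> E0; have := pE om x ad px; rewrite E0.
rewrite /hausdorff_dim; case: asboolP => // _.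
apply: le_ereal_inf_tmp => _ [t' [t'0 ht'] <-]; rewrite lee_fin leNgt.
apply/negP => t't; move: ht'.
exact: (path_points_hausdorff_pos hr hS rho00 SD isolated uW sizeW sumW slowW t'0 t't pE).
Qed.

End AbscissaLeSpectrum.

Theorem theorem1p1 (R : realType) (d N : nat)
  (S : 'I_N -> 'rV[R]_d -> 'rV[R]_d) (r p : 'I_N -> R)
  (mu : probability (borelRd R d) R)
  (hd : (0 < d)%N)
  (hr : forall i, 0 < r i < 1)
  (hS : forall i, is_similarity (S i) (r i))
  (hp : forall i, 0 < p i)
  (hp1 : \sum_(i < N) p i = 1)
  (hmu : self_similar_measure S p mu)
  (hOSC : open_set_condition S)
  (alpha : R) :
  (sigma_ab_zeta_sim r p alpha rho @[rho --> 0^'+] --> mf_spectrum mu alpha) /\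
  mf_spectrum mu alpha = coarse_spectrum mu alpha.
Proof.
have [V [[x Vx] _ openV SV dV]] := hOSC.
have [c c0 xV] := open_eball_sub openV Vx.
have [rho0 [rho00 SD muD]] := exists_invariant_ball hr hS hp hp1 hmu x.
set sigma := sigma_ab_zeta_sim r p alpha.
set coarse := coarse_spectrum_at mu alpha.
have cvg_sigma := nondecreasing_cvg_inf
  (fun x y _ => @sigma_ab_nondecreasing R N r p alpha x y).
have cvg_coarse := nondecreasing_cvg_inf
  (fun x y _ => @coarse_spectrum_at_nondecreasing R d mu alpha x y).
set g := ereal_inf _ in cvg_sigma; set h := ereal_inf _ in cvg_coarse.
have mf_h : (mf_spectrum mu alpha <= h)%E.
  by apply: le_ereal_inf_tmp => _ [rho rho_gt0 <-]; exact: mf_spectrum_le_coarse.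
have h_g : (h <= g)%E.
  apply: le_ereal_inf_tmp => _ [rho /= rho_gt0 <-].
  have rho20 : 0 < rho / 2 by rewrite divr_gt0.
  apply: (@le_trans _ _ (coarse (rho / 2))).
    by apply: ereal_inf_lbound; exists (rho / 2).
  apply: (coarse_spectrum_le_abscissa hd hr hS hp hmu c0 xV SV dV rho00 muD) => //.
  lra.
have le_g_mf : (g <= mf_spectrum mu alpha)%E.
  apply: lee_lt_real => t tg.
  have [t1 tt1 t1g] := lt_real_between tg.
  apply: (abscissa_le_mf_spectrum hd hr hS hp hp1 hmu c0 xV SV dV rho00 SD muD tt1).
  move=> rho rho_gt0; apply: (lt_le_trans t1g).
  by apply: ereal_inf_lbound; exists rho.
have mfg : mf_spectrum mu alpha = g.
  by apply/eqP; rewrite eq_le le_g_mf (le_trans mf_h h_g).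
have mfh : mf_spectrum mu alpha = h.
  by apply/eqP; rewrite eq_le mf_h (le_trans h_g le_g_mf).
split; first by rewrite mfg.
by rewrite mfh /coarse_spectrum (cvg_lim _ cvg_coarse).
Qed.
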